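(* Let $r_1(\boldsymbol{k})=\max\left(1,\log\min_{j\in\operatorname{supp}(\boldsymbol{k})}|k_j|\right)$ for $\boldsymbol{k}\in\mathbb{Z}^d\setminus\{\boldsymbol{0}\}$ and $r_1(\boldsymbol{0})=1$. There exists a constant $C>0$ such that for every $d\in\mathbb{N}$ and every $\varepsilon\in(0,1)$, \[n^{\mathrm{ran}}(\varepsilon,d,F_{d,r_1})\leq C\,\varepsilon^{-1}.\]
   Context: For a weight function $r:\mathbb{Z}^d\to[1,\infty)$, let \[F_{d,r}=\Big\{f\in C([0,1)^d)\ \text{real-valued}:\ \|f\|:=\sum_{\boldsymbol{k}\in\mathbb{Z}^d}|\hat f(\boldsymbol{k})|\,r(\boldsymbol{k})<\infty\Big\},\qquad \hat f(\boldsymbol{k})=\int_{[0,1)^d}f(\boldsymbol{x})e^{-2\pi\mathrm{i}\boldsymbol{k}\cdot\boldsymbol{x}}\,\mathrm{d}\boldsymbol{x},\] and $I_d(f)=\int_{[0,1)^d}f$. A deterministic linear algorithm has the form $Q(f)=\sum_{h=0}^{n-1}c_hf(\boldsymbol{x}_h)$ with $\boldsymbol{x}_h\in[0,1)^d$, $c_h\in\mathbb{R}$. A randomized algorithm $A_d$ is a probability space $(\Omega,\Sigma,\mu)$ together with a family $(Q_{d,\omega})_{\omega\in\Omega}$ of such deterministic algorithms; the number of points used by $Q_{d,\omega}$ on $f$ is denoted $n(f,\omega)$ (it may depend on $\omega$ and $f$). Its cardinality is $\#(A_d)=\sup_{f\in F_{d,r}}\mathbb{E}_\omega[n(f,\omega)]$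 and its randomized error is $e^{\mathrm{ran}}(F_{d,r},A_d)=\sup_{f\in F_{d,r},\|f\|\leq1}\mathbb{E}_\omega[|I_d(f)-Q_{d,\omega}(f)|]$. The randomized information complexity is $n^{\mathrm{ran}}(\varepsilon,d,F_{d,r})=\min\{n\in\mathbb{N}:\exists A_d\text{ with }e^{\mathrm{ran}}(F_{d,r},A_d)\leq\varepsilon\text{ and }\#(A_d)\leq n\}$. $\operatorname{supp}(\boldsymbol{k})=\{j:k_j\neq0\}$ and $\log$ is the natural logarithm. *)

(* Defs.v *)
From HB Require Import structures.
From mathcomp Require Import all_boot all_order all_algebra complex.
From mathcomp Require Import all_classical all_reals all_analysis.

Set Implicit Arguments.
Unset Strict Implicit.
Unset Printing Implicit Defensive.

Import Order.TTheory GRing.Theory Num.Theory.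
Import numFieldNormedType.Exports.

Local Open Scope classical_set_scope.
Local Open Scope ring_scope.

(** The library only has binary product measures: Lebesgue measure on n-tuples
    is obtained by iterating them along (x, t) |-> x :: t. *)
Section lebesgue_tuple.
Variable R : realType.
Local Notation RT := (measurableTypeR R).

Definition tcons n (p : RT * n.-tuple RT) : n.+1.-tuple RT :=
  [tuple of p.1 :: p.2].

Definition tuncons n (t : n.+1.-tuple RT) : RT * n.-tuple RT :=
  (thead t, [tuple of behead t]).

Lemma measurable_tcons n : measurable_fun setT (@tcons n).
Proof. exact: measurable_cons. Qed.

Lemma measurable_tuncons n : measurable_fun setT (@tuncons n).
Proof.
apply/measurable_fun_pairP; split; first exact: (measurable_tnth ord0).
exact: measurable_behead.
Qed.

Lemma tconsK n : cancel (@tcons n) (@tuncons n).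
Proof. by case=> x t; congr pair; exact/val_inj. Qed.

Lemma tunconsK n : cancel (@tuncons n) (@tcons n).
Proof. by move=> t; rewrite /tcons /= -tuple_eta. Qed.

Section step.
Variables (n : nat) (mu : {sigma_finite_measure set (n.-tuple RT) -> \bar R}).

Definition lebesgue_tupleS : set (n.+1.-tuple RT) -> \bar R :=
  pushforward (@lebesgue_measure R \x mu)%E (@tcons n).

Let m0 : lebesgue_tupleS set0 = 0%E.
Proof. by rewrite /lebesgue_tupleS /pushforward preimage_set0 measure0. Qed.

Let m_ge0 A : (0 <= lebesgue_tupleS A)%E.
Proof. exact: (measure_ge0 (@lebesgue_measure R \x mu)%E). Qed.

Let m_sigma_additive : semi_sigma_additive lebesgue_tupleS.
Proof.
have mt := @measurable_tcons n.
move=> F mF tF mUF; rewrite /lebesgue_tupleS /pushforward preimage_bigcup.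
apply: measure_semi_sigma_additive.
- by move=> i; rewrite -[X in measurable X]setTI; exact: mt.
- apply/trivIsetP => /= i j _ _ ij; rewrite -preimage_setI.
  by move/trivIsetP : tF => /(_ _ _ _ _ ij) ->//; rewrite preimage_set0.
- by rewrite -preimage_bigcup -[X in measurable X]setTI; exact: mt.
Qed.

HB.instance Definition _ :=
  isMeasure.Build _ _ _ lebesgue_tupleS m0 m_ge0 m_sigma_additive.

Let m_sigma_finite : sigma_finite setT lebesgue_tupleS.
Proof.
have /sigma_finiteP[F [TF ndF Foo]] := sigma_finiteT (@lebesgue_measure R).
have /sigma_finiteP[G [TG ndG Goo]] := sigma_finiteT mu.
exists (fun i => @tuncons n @^-1` (F i `*` G i)).
  apply/esym; rewrite -subTset => t _.
  have [i _ Fi] : (\bigcup_i F i) (tuncons t).1 by rewrite -TF.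
  have [j _ Gj] : (\bigcup_i G i) (tuncons t).2 by rewrite -TG.
  exists (maxn i j) => //; split.
    by move: Fi; exact/subsetPset/ndF/leq_maxl.
  by move: Gj; exact/subsetPset/ndG/leq_maxr.
move=> i; have [? ?] := Foo i; have [? ?] := Goo i; split.
  rewrite -[X in measurable X]setTI.
  by apply: measurable_tuncons => //; exact: measurableX.
rewrite /lebesgue_tupleS /pushforward -comp_preimage.
rewrite (_ : _ \o _ = id) ?preimage_id//; last exact/funext/tconsK.
by rewrite product_measure1E// lte_mul_pinfty// ge0_fin_numE.
Qed.

HB.instance Definition _ :=
  Measure_isSigmaFinite.Build _ _ _ lebesgue_tupleS m_sigma_finite.

End step.

Fixpoint lebesgue_tuple n : {sigma_finite_measure set (n.-tuple RT) -> \bar R} :=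
  match n with
  | 0 => \d_([tuple] : 0.-tuple RT)
  | m.+1 => lebesgue_tupleS (lebesgue_tuple m)
  end.

End lebesgue_tuple.

Section function_space.
Variables (R : realType) (d : nat).
Implicit Types (f : 'rV[R]_d -> R) (x : 'rV[R]_d) (k : 'rV[int]_d).

Definition cube : set 'rV[R]_d := [set x | forall j, 0 <= x ord0 j < 1].

Definition row_of_tuple (t : d.-tuple (measurableTypeR R)) : 'rV[R]_d :=
  \row_j tnth t j.

Definition cube_tuple : set (d.-tuple (measurableTypeR R)) :=
  row_of_tuple @^-1` cube.

Definition cube_integrable f : Prop :=
  (lebesgue_tuple R d).-integrable cube_tuple (fun t => (f (row_of_tuple t))%:E).

Definition cube_integral f : R :=
  (\int[lebesgue_tuple R d]_(t in cube_tuple) f (row_of_tuple t))%R.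

Definition cube_integralC (g : 'rV[R]_d -> R[i]) : R[i] :=
  (cube_integral (fun x => complex.Re (g x)) +i*
   cube_integral (fun x => complex.Im (g x)))%C.

Definition expi (theta : R) : R[i] := (cos theta +i* sin theta)%C.

Definition dot k x : R := \sum_j (k ord0 j)%:~R * x ord0 j.

Definition fourier_coef f k : R[i] :=
  cube_integralC (fun x => (f x)%:C%C * expi (- (2 * pi * dot k x))).

Definition wiener_norm (r : 'rV[int]_d -> R) f : \bar R :=
  (\esum_(k in [set: 'rV[int]_d])
     (ComplexField.Normc.normc (fourier_coef f k) * r k)%:E)%E.

(** Elements are represented by functions on R^d of which only the restriction
    to the cube matters.  A continuous function on the half-open cube may fail
    to be integrable, and Fourier coefficients are then meaningless (the
    library's integral returns a junk value), hence the second conjunct. *)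
Definition wiener_space (r : 'rV[int]_d -> R) : set ('rV[R]_d -> R) :=
  [set f | [/\ {within cube, continuous f}, cube_integrable f &
               (wiener_norm r f < +oo)%E]].

End function_space.

Section randomized_algorithms.
Variables (R : realType) (d : nat).

Record linear_algorithm := LinearAlgorithm {
  npoints : nat;
  weight : 'I_npoints -> R;
  node : 'I_npoints -> 'rV[R]_d;
  node_cube : forall h, cube (node h) }.

Definition run (Q : linear_algorithm) (f : 'rV[R]_d -> R) : R :=
  \sum_(h < npoints Q) weight h * f (node h).

(** The measurability fields are what makes the expectations below
    meaningful. *)
Record randomized_algorithm (F : set ('rV[R]_d -> R)) := RandomizedAlgorithm {
  ra_display : measure_display;
  ra_sample : measurableType ra_display;
  ra_prob : probability ra_sample R;
  ra_alg : ra_sample -> linear_algorithm;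
  ra_measurable_run : forall f, F f ->
    measurable_fun [set: ra_sample] (fun w => run (ra_alg w) f);
  ra_measurable_npoints :
    measurable_fun [set: ra_sample] (fun w => (npoints (ra_alg w))%:R : R) }.

Variable r : 'rV[int]_d -> R.
Local Notation F := (wiener_space r).

(** The number of points used on [f]; a linear algorithm evaluates every input
    at the same nodes, so it does not actually vary with [f]. *)
Definition points_used (A : randomized_algorithm F) (f : 'rV[R]_d -> R)
  (w : ra_sample A) : nat := npoints (ra_alg w).

Definition ran_card (A : randomized_algorithm F) : \bar R :=
  ereal_sup [set 'E_(ra_prob A)[fun w => (points_used f w)%:R] | f in F]%E.

Definition ran_error (A : randomized_algorithm F) : \bar R :=
  ereal_sup [set 'E_(ra_prob A)[fun w => `|cube_integral f - run (ra_alg w) f|%R]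
            | f in F `&` [set f | (wiener_norm r f <= 1)%E]]%E.

(** The minimum of the admissible n, and +oo if there is none. *)
Definition ran_complexity (eps : R) : \bar R :=
  ereal_inf [set n%:R%:E | n in [set n : nat | (0 < n)%N /\
    exists A : randomized_algorithm F,
      (ran_error A <= eps%:E)%E /\ (ran_card A <= n%:R%:E)%E]].

End randomized_algorithms.

(** [pick] fails exactly when k = 0; otherwise it supplies the index in the
    support that the [arg min] notation needs as a default. *)
Definition r1 (R : realType) (d : nat) (k : 'rV[int]_d) : R :=
  if [pick j | k ord0 j != 0] is Some j0 then
    Num.max 1
      (ln (absz (k ord0 [arg min_(j < j0 | k ord0 j != 0) absz (k ord0 j)]))%:R)
  else 1.

Lemma r1_0 (R : realType) (d : nat) : r1 R (0 : 'rV[int]_d) = 1.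
Proof. by rewrite /r1; case: pickP => // j; rewrite mxE eqxx. Qed.

Lemma r1_ge1 (R : realType) (d : nat) (k : 'rV[int]_d) : 1 <= r1 R k.
Proof. by rewrite /r1; case: pickP => // j _; rewrite le_max lexx. Qed.

(* Main.v *)
From HB Require Import structures.
Require Import Defs.
From mathcomp Require Import all_boot all_order all_algebra complex.
From mathcomp Require Import zify ring lra.

(** The algorithm is a randomized rank-1 lattice rule: with N = 4^b of order
    1/eps, draw a prime p uniformly from (N/4, N], then a generating vector z
    uniformly from (Z/p)^d, and average f over the p nodes.  The rule makes an
    error on the k-th harmonic only if p divides k.z.  If j minimizes |k_j| over
    the support of k, this has probability at most 1/p + Pr(p | k_j).  At most
    O(log |k_j| / log N) primes of (N/4, N] divide k_j, whereas by Chebyshev there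
    are at least c N / log N primes to choose from, so the probability is
    O(r_1(k) / N) and the expected error is at most 20 ||f|| / N.

    The expansion of f in harmonics is never summed pointwise.  Instead f is
    convolved with the product kernel proportional to prod_j cos(pi t_j)^(2n): the
    result is a trigonometric polynomial with coefficients of modulus at most
    |f^(k)|, and it converges to f at every interior point of the cube.  This
    kernel is preferred to Fejer's because it decays exponentially in n off the
    diagonal, so that the convergence holds for unbounded integrable f in any
    dimension. *)

Set Implicit Arguments.
Unset Strict Implicit.
Unset Printing Implicit Defensive.

(** * Primes in (N/4, N] *)

Lemma prod_prime_dvd (s : seq nat) (m : nat) :
  uniq s -> all prime s -> all (dvdn^~ m) s -> \prod_(p <- s) p %| m.
Proof.
elim: s => [|p s IH] /=; first by rewrite big_nil dvd1n.
move=> /andP[pNs us] /andP[pp ps] /andP[pm sm].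
rewrite big_cons Gauss_dvd ?pm ?IH//.
rewrite big_seq; elim/big_ind: _ => [|x y cx cy|q qs]; first exact: coprimen1.
  by rewrite coprimeMr cx.
rewrite prime_coprime// dvdn_prime2// ?(allP ps)//.
by apply: contraNneq pNs => ->.
Qed.

(** The coefficients increase up to the middle index, and the upper half mirrors the lower one. *)
Lemma leq_central_bin n i : 'C(n.*2, i) <= 'C(n.*2, n).
Proof.
have step j : j < n -> 'C(n.*2, j) <= 'C(n.*2, j.+1).
  move=> jn; rewrite -(leq_pmul2l (ltn0Sn j)).
  by rewrite mul_bin_left leq_mul2r; apply/orP; right; lia.
have low j : j <= n -> 'C(n.*2, j) <= 'C(n.*2, n).
  move=> jn; rewrite -(subKn jn); elim: (n - j) => [|m IH]; first by rewrite subn0.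
  case: (ltnP m n) => mn; last first.
    by have -> : n - m.+1 = n - m by lia.
  apply: leq_trans IH; have -> : n - m = (n - m.+1).+1 by lia.
  by apply: step; lia.
case: (leqP i n) => [/low//|ni].
case: (leqP i n.*2) => [i2n|/bin_small->//].
by rewrite -bin_sub//; apply: low; lia.
Qed.

(** The 2n + 1 coefficients of (1 + 1)^(2n) sum to 4^n and none exceeds the central one. This serves
    both the count of primes and the decay of the kernel. *)
Lemma expn4_leq_central_bin n : 4 ^ n <= n.*2.+1 * 'C(n.*2, n).
Proof.
have -> : 4 ^ n = 2 ^ n.*2 by rewrite -mul2n expnM.
rewrite -[2]/(1 + 1) expnDn -[X in X * _]card_ord -sum_nat_const.
apply: leq_sum => i _; rewrite !exp1n !muln1; exact: leq_central_bin.
Qed.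

Lemma central_bin_leq n : 'C(n.*2, n) <= 4 ^ n.
Proof.
have -> : 4 ^ n = 2 ^ n.*2 by rewrite -mul2n expnM.
have nS : n < n.*2.+1 by lia.
rewrite -[2]/(1 + 1) expnDn (bigD1 (Ordinal nS))//= !exp1n !muln1.
exact: leq_addr.
Qed.

Lemma prime_dvd_fact p m : prime p -> p %| m`! -> p <= m.
Proof.
move=> pp; elim: m => [|m IH]; first by rewrite fact0 Euclid_dvd1.
rewrite factS Euclid_dvdM// => /orP[/dvdn_leq->//|/IH]; exact: leqW.
Qed.

Lemma prime_dvd_central_bin p m :
  prime p -> m < p <= m.*2 -> p %| 'C(m.*2, m).
Proof.
move=> pp /andP[mp pm].
have : p %| m.*2`! by rewrite dvdn_fact// prime_gt0.
have mm : m <= m.*2 by lia.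
rewrite -(bin_fact mm) -{2}addnn addnK Euclid_dvdM// => /orP[//|].
by rewrite Euclid_dvdM// orbb => /(prime_dvd_fact pp); lia.
Qed.

(** Doubling: the primes of (m, 2m] all divide 'C(2m, m), so their product is at most 4^m, and 4^m *
    4^m = 4^(2m). *)
Lemma primorial_leq a :
  \prod_(p <- iota 0 (2 ^ a).+1 | prime p) p <= 4 ^ 2 ^ a.
Proof.
elim: a => [|a IH]; first by rewrite unlock.
set m := 2 ^ a in IH *; have -> : 2 ^ a.+1 = m.*2 by rewrite expnS mul2n.
have -> : m.*2.+1 = m.+1 + m by rewrite -addnn.
rewrite iotaD big_cat/= add0n -addnn expnD leq_mul//.
apply: leq_trans (central_bin_leq m); apply: dvdn_leq.
  by rewrite bin_gt0 -addnn leq_addr.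
rewrite -big_filter; apply: prod_prime_dvd.
- by rewrite filter_uniq// iota_uniq.
- exact: filter_all.
- apply/allP => p; rewrite mem_filter mem_iota => /and3P[pp mp pm].
  by apply: prime_dvd_central_bin => //; lia.
Qed.

(** Legendre's formula: p^k contributes floor(2n / p^k) - 2 floor(n / p^k), which is at most 1, and
    is 0 as soon as p^k > 2n. *)
Lemma logn_central_bin_leq p n B : prime p -> n.*2 < p ^ B.+1 ->
  logn p 'C(n.*2, n) <= B.
Proof.
move=> pp nB; have mm : n <= n.*2 by lia.
have C0 : 0 < 'C(n.*2, n) by rewrite bin_gt0.
have := congr1 (logn p) (bin_fact mm).
rewrite -{2}addnn addnK !lognM ?muln_gt0 ?fact_gt0// !logn_fact//.
(* The added terms vanish because n < p^k there; both Legendre sums then run over the same range and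
   can be compared termwise. *)
have -> : \sum_(1 <= k < n.+1) n %/ p ^ k = \sum_(1 <= k < n.*2.+1) n %/ p ^ k.
  rewrite [RHS](@big_cat_nat _ _ _ n.+1)//= [X in _ = _ + X]big1_seq ?addn0//.
  move=> k /andP[_]; rewrite mem_index_iota => /andP[nk _].
  by rewrite divn_small// (leq_trans nk)// ltnW// ltn_expl// prime_gt1.
have pe k : n.*2 %/ p ^ k <= n %/ p ^ k + n %/ p ^ k + (k <= B).
  case: (leqP k B) => kB /=; last first.
    rewrite divn_small// (leq_trans nB)// leq_pexp2l// prime_gt0//.
  have pk : 0 < p ^ k by rewrite expn_gt0 prime_gt0.
  rewrite -ltnS ltn_divLR//.
  by have := ltn_ceil n pk; nia.
have : \sum_(1 <= k < n.*2.+1) n.*2 %/ p ^ k <=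
  \sum_(1 <= k < n.*2.+1) (n %/ p ^ k + n %/ p ^ k + (k <= B)).
  by apply: leq_sum => k _; exact: pe.
rewrite !big_split/=.
have : \sum_(1 <= k < n.*2.+1) (k <= B : nat) <= B.
  rewrite -big_mkcond/= sum1_count -size_filter /index_iota.
  rewrite -[X in _ <= X](size_iota 1); apply: uniq_leq_size.
    by rewrite filter_uniq// iota_uniq.
  by move=> k; rewrite mem_filter !mem_iota; lia.
lia.
Qed.

(** Indexing by all primes up to B, instead of the prime divisors of m, allows the product to be cut
    into intervals. *)
Lemma prime_pfactor_prod m B : 0 < m -> {in \pi(m), forall p, p <= B} ->
  m = \prod_(p <- iota 0 B.+1 | prime p) p ^ logn p m.
Proof.
move=> m0 mB; rewrite {1}(prod_prime_decomp m0) prime_decompE big_map/=.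
rewrite [RHS](bigID (mem (primes m)))/= [X in _ = _ * X]big1 ?muln1; last first.
  move=> p /andP[pp]; rewrite mem_primes pp m0/= => pm.
  by rewrite lognE pp m0 (negbTE pm).
rewrite -[RHS]big_filter; apply: perm_big; apply: uniq_perm.
- exact: primes_uniq.
- by rewrite filter_uniq//; exact: (iota_uniq 0 B.+1).
move=> p; rewrite -[0 :: _]/(iota 0 B.+1) mem_filter mem_iota/= add0n ltnS.
case pm: (p \in primes m); last by rewrite andbF.
by rewrite mB//; move: pm; rewrite mem_primes => /andP[->].
Qed.

Definition primes_in a b := [seq p <- iota a.+1 (b - a) | prime p].

Lemma leq_prod_count (T : Type) (s : seq T) (P : pred T) (F : T -> nat) c :
  (forall i, P i -> F i <= c) -> \prod_(i <- s | P i) F i <= c ^ count P s.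
Proof.
move=> Fc; apply: (@leq_trans (\prod_(i <- s | P i) c)); first exact: leq_prod.
by rewrite big_const_seq iter_muln_1.
Qed.

(* Chebyshev's lower bound, read off 'C(2n, n) with 2n = 4^k. *)
Lemma many_primes k : 5 < k ->
  4 ^ k <= 8 * k * size (primes_in (4 ^ k.-1) (4 ^ k)).
Proof.
move=> k5; set N := 4 ^ k; set M := size _.
pose n := N./2.
have k4 : 4 ^ k.-1 = 2 ^ k.-1.*2 by rewrite -mul2n expnM.
have NE : N = 4 * 4 ^ k.-1 by rewrite -expnS prednK//; lia.
have nN : n.*2 = N by rewrite /n; lia.
have N2 : N = 2 ^ k * 2 ^ k by rewrite -expnD addnn -mul2n expnM.
set X := 'C(n.*2, n).
have X0 : 0 < X by rewrite bin_gt0; lia.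
have XB : {in \pi(X), forall p, p <= N}.
  move=> p; rewrite mem_primes => /and3P[pp _ pX].
  apply: prime_dvd_fact pp _; rewrite -nN.
  have mm : n <= n.*2 by lia.
  by rewrite -(bin_fact mm) dvdn_mulr.
have pN p : prime p -> p ^ logn p X <= N.
  move=> pp; have p1 := prime_gt1 pp.
  have N0 : 0 < N by rewrite expn_gt0.
  apply: leq_trans (trunc_logP p1 N0); rewrite leq_exp2l//.
  by apply: logn_central_bin_leq => //; rewrite nN trunc_log_ltn.
have kN : 2 ^ k <= 4 ^ k.-1 by rewrite k4 leq_exp2l//; lia.
(* The factorization of X is cut at 2^k = sqrt N and at N/4. Prime powers of the first and last
   ranges are at most N each; in the middle range exponents are at most 1, so the primorial bound
   applies. *)
have main : X <= N ^ (2 ^ k).+1 * (4 ^ 4 ^ k.-1 * N ^ M).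
  rewrite (prime_pfactor_prod X0 XB).
  have -> : N.+1 = (2 ^ k).+1 + (4 ^ k.-1 - 2 ^ k) + (N - 4 ^ k.-1) by lia.
  rewrite !iotaD !big_cat/= -mulnA !add0n.
  have -> : (2 ^ k).+1 + (4 ^ k.-1 - 2 ^ k) = (4 ^ k.-1).+1 by lia.
  apply: leq_mul; last apply: leq_mul.
  - apply: leq_trans (leq_prod_count _ pN) _.
    by rewrite leq_pexp2l ?expn_gt0// -[leqRHS](size_iota 0) count_size.
  - rewrite k4; apply: leq_trans (primorial_leq _); rewrite -k4.
    have -> : (4 ^ k.-1).+1 = (2 ^ k).+1 + (4 ^ k.-1 - 2 ^ k) by lia.
    rewrite iotaD big_cat/= add0n.
    apply: leq_trans (leq_pmull _ _); last first.
      by rewrite big_seq_cond prodn_cond_gt0// => p /andP[_ /prime_gt0].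
    rewrite big_seq_cond [leqRHS]big_seq_cond; apply: leq_prod => p.
    rewrite mem_iota => /andP[/andP[kp _] pp].
    rewrite -[leqRHS]expn1 leq_exp2l ?prime_gt1//.
    by apply: logn_central_bin_leq => //; rewrite nN N2 expnS expn1; nia.
  - by rewrite /M /primes_in size_filter; exact: leq_prod_count.
have := expn4_leq_central_bin n; rewrite -/X => h4.
have NX : n.*2.+1 <= N ^ 2.
  by rewrite nN; have := ltn_expl k (isT : 1 < 4); rewrite -/N; nia.
have : 4 ^ n <= N ^ 2 * (N ^ (2 ^ k).+1 * (4 ^ 4 ^ k.-1 * N ^ M)).
  by apply: leq_trans h4 _; apply: leq_mul.
rewrite -!expnM -!expnD leq_exp2l// => h.
(* Comparing exponents of 4 has left N/4 <= k (2^k + 3) + k M. Since k > 5 gives 9 k <= 2^k, the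
   first term is at most N/8. *)
have hk : k * 8 * ((2 ^ k).+1 + 2) <= N.
  have : 9 * k <= 2 ^ k.
    rewrite -(subnKC k5); elim: (k - 6) => // j IH.
    by rewrite addnS expnS; lia.
  rewrite N2; nia.
nia.
Qed.

(** The product of the primes in s divides m, and each of them is at least 2^k. *)
Lemma prime_divisors_count k m (s : seq nat) : 0 < m -> uniq s ->
  {in s, forall p, [/\ prime p, 2 ^ k <= p & p %| m]} ->
  2 ^ (k * size s) <= m.
Proof.
move=> m0 us sP; apply: (@leq_trans (\prod_(p <- s) p)); last first.
  apply: dvdn_leq => //.
  by apply: prod_prime_dvd => //; apply/allP => p /sP[].
elim: s {us} sP => [|p s IH] sP; first by rewrite big_nil muln0.
rewrite big_cons mulnS expnD leq_mul ?IH//.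
  by case: (sP p (mem_head _ _)).
by move=> q qs; apply: sP; rewrite inE qs orbT.
Qed.

Import Order.TTheory GRing.Theory Num.Theory.
Local Open Scope ring_scope.

(** * Vectors of the dual lattice *)

Definition zdot d p (k : 'rV[int]_d) (z : {ffun 'I_d -> 'I_p}) : int :=
  \sum_j k ord0 j * (z j : nat)%:Z.

(* Translating a solution z along the j-th axis by the p residues gives p
   distinct points, and the points obtained from distinct solutions differ. *)
Lemma card_dual_lattice d p (k : 'rV[int]_d) j : prime p ->
  ~~ (p%:Z %| k ord0 j)%Z ->
  ((\sum_(z : {ffun 'I_d -> 'I_p} | (p%:Z %| zdot k z)%Z) 1) * p <= p ^ d)%N.
Proof.
move=> pp pk; rewrite sum1dep_card; set A := [set z | _]; have p0 := prime_gt0 pp.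
pose f (u : {ffun 'I_d -> 'I_p} * 'I_p) : {ffun 'I_d -> 'I_p} :=
  [ffun i => if i == j then Ordinal (ltn_pmod (u.1 j + u.2) p0) else u.1 i].
have finj : {in setX A [set: 'I_p] &, injective f}.
  move=> [z c] [z' c']; rewrite !inE/= !andbT => zA zA' E.
  have zi i : i != j -> z i = z' i.
    by move=> ij; have /ffunP/(_ i) := E; rewrite !ffunE (negbTE ij).
  have zj : z j = z' j.
    have : (p%:Z %| zdot k z - zdot k z')%Z by rewrite rpredB.
    rewrite /zdot -sumrB (bigD1 j)//= big1 => [|i /zi ->]; last by rewrite subrr.
    rewrite addr0 -mulrBr dvdzE abszM Euclid_dvdM// -!dvdzE (negbTE pk)/=.
    by rewrite -eqz_mod_dvd !modz_nat !modn_small// => /eqP[/val_inj].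
  have ez : z = z' by apply/ffunP => i; case: (eqVneq i j) => [->//|/zi].
  have /ffunP/(_ j) := E; rewrite !ffunE eqxx => /(congr1 val)/=.
  rewrite -ez => /eqP; rewrite eqn_modDl !modn_small// => /eqP cc.
  by congr (_, _); exact: val_inj.
rewrite -[X in (_ * X)%N](card_ord p) -cardsT -cardsX -(card_in_imset finj).
apply: leq_trans (max_card _) _.
by rewrite card_ffun !card_ord.
Qed.

From mathcomp Require Import all_classical all_reals all_analysis.
From mathcomp Require Import measurable_realfun.

Import numFieldNormedType.Exports.
Local Open Scope classical_set_scope.

(** * Finite probability spaces and product integrals *)

(** The finite space is carried to [nat] by the index in [enum W], as a weighted sum of Dirac
    masses: on [nat] every set, hence every function, is measurable. *)
Lemma finite_probability (R : realType) (W : finType) (w0 : W) (c : W -> R) :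
  (forall w, 0 <= c w) -> \sum_w c w = 1 ->
  exists P : probability nat R, forall X : nat -> R, (forall n, 0 <= X n) ->
    ('E_P[X] = (\sum_w c w * X (index w (enum W)))%:E)%E.
Proof.
move=> c0 c1; pose w_ i := nth w0 (enum W) i.
pose m (i : nat) : {measure set nat -> \bar R} := mscale (NngNum (c0 (w_ i))) \d_i.
pose mu : {measure set nat -> \bar R} := msum m #|W|.
have sumE (g : nat -> R) :
    \sum_(i < #|W|) c (w_ i) * g i = \sum_w c w * g (index w (enum W)).
  rewrite -[RHS]big_enum (big_nth w0) big_mkord -cardE; apply: eq_bigr => i _.
  by rewrite index_uniq ?enum_uniq// -[X in (_ < X)%N]cardE.
have mu1 : (mu setT = 1)%E.
  rewrite /mu/= /msum/= -[RHS]/(1%:E) -c1.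
  under eq_bigr do rewrite /mscale/= diracT mule1.
  rewrite sumEFin; congr EFin; transitivity (\sum_(i < #|W|) c (w_ i) * 1).
    by apply: eq_bigr => i _; rewrite mulr1.
  by rewrite (sumE (fun=> 1)); apply: eq_bigr => i _; rewrite mulr1.
pose Pm := Measure_isProbability.Build _ _ _ mu mu1.
pose P : probability nat R := HB.pack (Measure.sort mu) (Measure.class mu) Pm.
exists P => X X0; rewrite unlock.
have -> : (\int[P]_x (X x)%:E = \int[msum m #|W|]_x (X x)%:E)%E by [].
rewrite ge0_integral_measure_sum//= => [|n _]; last by rewrite lee_fin.
rewrite -sumE -sumEFin; apply: eq_bigr => i _.
rewrite ge0_integral_mscale//= => [|n _]; last by rewrite lee_fin.
by rewrite integral_dirac//= diracT mul1e.
Qed.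

Section tuple_integral.
Variable R : realType.
Local Notation RT := (measurableTypeR R).

Lemma measurable_prod_tnth n (u : 'I_n -> R -> R) :
  (forall i, measurable_fun [set: RT] (u i)) ->
  measurable_fun [set: n.-tuple RT] (fun t => \prod_i u i (tnth t i)).
Proof.
move=> mu; apply: (@measurable_prod _ _ _ _ _ _
  (fun i (t : n.-tuple RT) => u i (tnth t i))) => i _.
by apply: measurableT_comp (mu i) _; exact: measurable_tnth.
Qed.

(** Induction on n: the integral is pulled back along [tcons], and Tonelli's theorem splits off the
    first coordinate. *)
Lemma integral_lebesgue_tuple_prod n (u : 'I_n -> R -> R) :
  (forall i, measurable_fun [set: RT] (u i)) ->
  (forall i x, 0 <= u i x) ->
  (forall i, (\int[@lebesgue_measure R]_x (u i x)%:E = 1)%E) ->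
  (\int[lebesgue_tuple R n]_t (\prod_i u i (tnth t i))%:E = 1)%E.
Proof.
elim: n u => [|n IH] u mu u0 u1.
  under eq_integral do rewrite big_ord0.
  by rewrite integral_cst//= diracT mul1e.
pose v (p : RT * n.-tuple RT) : R :=
  u ord0 p.1 * \prod_(i < n) u (lift ord0 i) (tnth p.2 i).
have mP := measurable_prod_tnth mu.
have P0 (t : n.+1.-tuple RT) : (0 <= (\prod_i u i (tnth t i))%:E)%E.
  by rewrite lee_fin prodr_ge0.
have mv : measurable_fun setT v.
  apply: measurable_funM; first exact: measurableT_comp (mu ord0) _.
  exact: (measurableT_comp (measurable_prod_tnth (fun i => mu (lift ord0 i)))
            measurable_snd).
transitivity (\int[(@lebesgue_measure R \x lebesgue_tuple R n)%E]_p (v p)%:E)%E.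
  rewrite (@ge0_integral_pushforward _ _ _ _ _ _ (@measurable_tcons R n))//=.
  - rewrite preimage_setT; apply: eq_integral => -[x t] _ /=.
    rewrite /v big_ord_recl /=; congr (_ * _)%:E.
    by apply: eq_bigr => i _; rewrite (tnthS).
  - exact/measurable_EFinP.
rewrite fubini_tonelli1//=; last 2 first.
- exact/measurable_EFinP.
- by move=> p; rewrite lee_fin mulr_ge0// prodr_ge0.
rewrite -[RHS](u1 ord0); apply: eq_integral => x _.
rewrite /fubini_F /v/=; under eq_integral do rewrite EFinM.
rewrite ge0_integralZl//=; last 3 first.
- apply/measurable_EFinP.
  exact: (measurable_prod_tnth (fun i => mu (lift ord0 i))).
- by move=> t _; rewrite lee_fin prodr_ge0.
- by rewrite lee_fin.
by rewrite (IH (fun i => u (lift ord0 i))) ?mule1.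
Qed.

End tuple_integral.

(** * The smoothing kernel *)

Section expi.
Variable R : realType.
Implicit Types a b : R.

Lemma expiD a b : expi (a + b) = expi a * expi b.
Proof. by rewrite /expi cosD sinD; apply/eqP; rewrite eq_complex/= eqxx addrC eqxx. Qed.

Lemma expi0 : expi (0 : R) = 1.
Proof. by rewrite /expi cos0 sin0. Qed.

Lemma expi_sum (I : Type) (s : seq I) (F : I -> R) :
  expi (\sum_(i <- s) F i) = \prod_(i <- s) expi (F i).
Proof. exact: (big_morph _ expiD expi0). Qed.

Lemma expi_mulrn a n : expi (a *+ n) = expi a ^+ n.
Proof.
elim: n => [|n IH]; first by rewrite mulr0n expi0 expr0.
by rewrite mulrS expiD IH exprS.
Qed.

Lemma expiVr a : expi a * expi (- a) = 1.
Proof. by rewrite -expiD subrr expi0. Qed.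

End expi.

Section kernel.
Variable R : realType.

(* The Jackson-type kernel proportional to cos(pi t)^(2n), normalized to have
   integral 1 over a period. *)
Definition kappa n (t : R) : R :=
  (2 + 2 * cos (2 * pi * t)) ^+ n / 'C(n.*2, n)%:R.

(** The Fourier coefficient of [kappa n] at frequency i - n. *)
Definition kcoef n (i : nat) : R := 'C(n.*2, i)%:R / 'C(n.*2, n)%:R.

Lemma central_bin_gt0 n : 0 < 'C(n.*2, n)%:R :> R.
Proof. by rewrite ltr0n bin_gt0 -addnn leq_addr. Qed.

Lemma kcoef_ge0 n i : 0 <= kcoef n i.
Proof. by rewrite divr_ge0. Qed.

Lemma kcoef_le1 n i : kcoef n i <= 1.
Proof. by rewrite ler_pdivrMr ?central_bin_gt0// mul1r ler_nat leq_central_bin. Qed.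

Lemma kcoef_mid n : kcoef n n = 1.
Proof. by rewrite /kcoef divff// gt_eqF// central_bin_gt0. Qed.

Lemma kappa_ge0 n t : 0 <= kappa n t.
Proof. by rewrite divr_ge0. Qed.

(** Binomial theorem applied to 2 + 2 cos th = exp(-i th) (1 + exp(i th))^2. *)
Lemma kappaE n t : (kappa n t)%:C%C =
  \sum_(i < n.*2.+1) (kcoef n i)%:C%C * expi ((i%:R - n%:R) * (2 * pi * t)).
Proof.
set th := 2 * pi * t.
have E : (2 + 2 * cos th)%:C%C = expi (- th) * (1 + expi th) ^+ 2.
  have e1 : expi (- th) * expi th = 1 by rewrite mulrC expiVr.
  transitivity (expi (- th) + 2 * (expi (- th) * expi th)
                + expi (- th) * expi th * expi th); last by ring.
  rewrite e1 mulr1 mul1r /expi cosN sinN; apply/eqP; rewrite eq_complex/=.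
  by apply/andP; split; apply/eqP; ring.
rewrite /kappa -/th rmorphM rmorphXn/= E exprMn -exprM mul2n -expi_mulrn.
rewrite exprDn mulr_sumr mulr_suml; apply: eq_bigr => i _.
rewrite expr1n mul1r mulrBl expiD.
have -> : i%:R * th = th *+ i by rewrite mulr_natl.
have -> : - (n%:R * th) = (- th) *+ n by rewrite mulr_natl mulNrn.
rewrite !expi_mulrn /kcoef rmorphM/= rmorph_nat -[_ *+ 'C(_, _)]mulr_natl.
by ring.
Qed.

End kernel.

Lemma expi_2pi_int (R : realType) (m : int) : expi (2 * pi * m%:~R : R) = 1.
Proof.
have e1 n : expi (2 * pi * n%:R : R) = 1.
  rewrite mulr_natr expi_mulrn (_ : expi _ = 1) ?expr1n//.
  by rewrite mulr_natl /expi cos2pi sin2pi.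
case: m => n; first by rewrite -pmulrn e1.
by rewrite NegzE mulrNz mulrN -[LHS]mul1r -(e1 n.+1) pmulrn expiVr e1.
Qed.

Lemma cosD2pi_int (R : realType) (a : R) (m : int) :
  cos (a + 2 * pi * m%:~R) = cos a.
Proof.
have := congr1 (@complex.Re R) (expiD a (2 * pi * m%:~R)).
by rewrite expi_2pi_int mulr1.
Qed.

Lemma sinD2pi_int (R : realType) (a : R) (m : int) :
  sin (a + 2 * pi * m%:~R) = sin a.
Proof.
have := congr1 (@complex.Im R) (expiD a (2 * pi * m%:~R)).
by rewrite expi_2pi_int mulr1.
Qed.

Lemma Re_sum (R : realType) (I : Type) (s : seq I) (P : pred I) (F : I -> R[i]) :
  complex.Re (\sum_(i <- s | P i) F i) = \sum_(i <- s | P i) complex.Re (F i).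
Proof. by apply: (big_morph _ _ _) => [[? ?] [? ?]|]. Qed.

(** * Integrals of cosines and of the kernel over a period *)

Section period_integral.
Variable R : realType.
Local Notation mu := (@lebesgue_measure R).

Lemma continuous_cos_affine (w y : R) : continuous (fun x : R => cos (w * (x - y))).
Proof.
move=> x; apply: continuous_comp; last exact: continuous_cos.
by apply: cvgM; [exact: cvg_cst|apply: cvgB; [exact: cvg_id|exact: cvg_cst]].
Qed.

Lemma Rintegral_cos_period (m : int) (y : R) :
  \int[mu]_(x in `[0, 1]) cos (2 * pi * m%:~R * (x - y)) = (m == 0)%:R.
Proof.
have [->|m0] := eqVneq m 0.
  under eq_Rintegral do rewrite mulr0 mul0r cos0.
  by rewrite Rintegral_cst//= lebesgue_measure_itv/= lte01 sube0 mul1r.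
set w := 2 * pi * m%:~R.
have w0 : w != 0.
  by rewrite /w !mulf_eq0 !negb_or intr_eq0 m0 pnatr_eq0 (gt_eqF (pi_gt0 R)).
rewrite /Rintegral.
have dF x : is_derive x (1 : R) (fun x : R => w^-1 * sin (w * (x - y)))
    (cos (w * (x - y))).
  by apply: is_derive_eq; rewrite /GRing.scale/= subr0 mulr1 [cos _ * _]mulrC mulKf.
have cF : continuous (fun x : R => w^-1 * sin (w * (x - y))).
  by move=> z; apply/differentiable_continuous/derivable1_diffP; exact: ex_derive.
rewrite (@continuous_FTC2 _ _ (fun x => w^-1 * sin (w * (x - y))))//=.
(* The two ends of the period differ by m full turns, so the antiderivative takes the same value at
   both. *)
- have -> : w * (1 - y) = w * (0 - y) + 2 * pi * m%:~R by rewrite /w; ring.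
  by rewrite sinD2pi_int subrr.
- by apply: continuous_subspaceT => x; exact: continuous_cos_affine.
- split.
  + by move=> x _; exact: ex_derive.
  + apply: cvg_at_right_filter; exact: cF.
  + apply: cvg_at_left_filter; exact: cF.
- by move=> x _; rewrite derive1E; exact: derive_val.
Qed.

End period_integral.

Lemma Rintegral_sum d (T : measurableType d) (R : realType)
    (mu : {measure set T -> \bar R}) (D : set T) (I : Type) (s : seq I)
    (f : I -> T -> R) : measurable D ->
  (forall i, mu.-integrable D (EFin \o f i)) ->
  (\int[mu]_(x in D) (\sum_(i <- s) f i x) = \sum_(i <- s) \int[mu]_(x in D) f i x)%R.
Proof.
move=> mD fi; elim: s => [|i s IH].
  by under eq_Rintegral do rewrite big_nil; rewrite big_nil Rintegral_cst// mul0r.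
under eq_Rintegral do rewrite big_cons.
rewrite big_cons -IH -RintegralD//.
rewrite (_ : EFin \o _ = fun x => (\sum_(j <- s) (EFin \o f j) x)%E); last first.
  by apply/funext => x /=; rewrite sumEFin.
exact: integrable_sum.
Qed.

Section kernel_integral.
Variable R : realType.
Local Notation mu := (@lebesgue_measure R).

Lemma kappa_cosE n (t : R) : kappa n t =
  \sum_(i < n.*2.+1) kcoef R n i * cos (2 * pi * (i%:Z - n%:Z)%:~R * t).
Proof.
have := congr1 (@complex.Re R) (kappaE n t); rewrite Re_sum /= => ->.
apply: eq_bigr => i _; rewrite mul0r subr0 intrB -!pmulrn; congr (_ * cos _).
by ring.
Qed.

Lemma continuous_kappa n (y : R) : continuous (fun x : R => kappa n (x - y)).
Proof.
move=> x; apply: cvgMr_tmp.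
apply: (@continuous_comp _ _ _ (fun x => 2 + 2 * cos (2 * pi * (x - y)))
  (fun z => z ^+ n)).
  apply: cvgD; first exact: cvg_cst.
  by apply: cvgM; [exact: cvg_cst|exact: continuous_cos_affine].
exact: exprn_continuous.
Qed.

(** Only the frequency 0, that is i = n, survives integration, and its coefficient is 1. *)
Lemma Rintegral_kappa n (y : R) : \int[mu]_(x in `[0, 1]) kappa n (x - y) = 1.
Proof.
under eq_Rintegral do rewrite kappa_cosE.
have ci (w : R) : mu.-integrable `[0, 1] (EFin \o (fun x => cos (w * (x - y)))).
  apply: continuous_compact_integrable; first exact: segment_compact.
  by apply: continuous_subspaceT => x; exact: continuous_cos_affine.
rewrite Rintegral_sum//=; last first.
  by move=> i; apply: (integrableZl _ (kcoef R n i) (ci _)).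
have nS : (n < n.*2.+1)%N by lia.
rewrite (bigD1 (Ordinal nS))//= big1 ?addr0; last first.
  move=> i /eqP ni; rewrite RintegralZl// Rintegral_cos_period.
  rewrite subr_eq0; case: eqP => [[] e|]; last by rewrite mulr0.
  by case: ni; exact: val_inj.
by rewrite RintegralZl// Rintegral_cos_period subrr eqxx kcoef_mid mulr1.
Qed.

(** The interval is moved into the integrand to fit [integral_lebesgue_tuple_prod]; half-open, it
    matches the cube, and the endpoint 1 is negligible. *)
Lemma integral_kappa_itv n (y : R) :
  (\int[mu]_x (kappa n (x - y) * \1_`[0%R, 1%R[ x)%:E = 1)%E.
Proof.
transitivity (\int[mu]_(x in `[0%R, 1%R]) (kappa n (x - y))%:E)%E; last first.
  have ki : mu.-integrable `[0, 1] (EFin \o (fun x => kappa n (x - y))).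
    apply: continuous_compact_integrable; first exact: segment_compact.
    by apply: continuous_subspaceT => x; exact: continuous_kappa.
  rewrite -(fineK (integrable_fin_num _ ki))//; congr EFin.
  exact: Rintegral_kappa.
rewrite -integral_itv_bndo_bndc; last first.
  apply/measurable_EFinP; apply: measurable_funTS.
  by apply: continuous_measurable_fun => x; exact: continuous_kappa.
rewrite [RHS]integral_mkcond; apply: eq_integral => x _.
rewrite patchE indicE; case: ifPn => xI; first by rewrite mulr1.
by rewrite mulr0.
Qed.

End kernel_integral.

(** * The product kernel on the cube *)

Section cube.
Variables (R : realType) (d : nat).
Local Notation mu := (lebesgue_tuple R d).
Local Notation D := (@cube_tuple R d).
Implicit Types (x y : 'rV[R]_d) (k : 'rV[int]_d).

Definition kerprod n y x : R := \prod_j kappa n (x ord0 j - y ord0 j).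

(** Coordinates of phi range over 0..2n; shifting them by n gives the frequencies of the product
    kernel, the box [-n, n]^d. *)
Definition freq n (phi : {ffun 'I_d -> 'I_n.*2.+1}) : 'rV[int]_d :=
  \row_j ((phi j)%:Z - n%:Z).

Lemma freq_inj n : injective (@freq n).
Proof.
move=> phi psi /rowP e; apply/ffunP => j; apply: val_inj.
by have := e j; rewrite !mxE => /addIr [].
Qed.

(** The product of the exponential sums is distributed over all choices phi of one frequency per
    coordinate, and real parts are taken. *)
Lemma kerprod_cosE n y x : kerprod n y x =
  \sum_(phi : {ffun 'I_d -> 'I_n.*2.+1}) (\prod_j kcoef R n (phi j)) *
    cos (2 * pi * (dot (freq phi) x - dot (freq phi) y)).
Proof.
have : (kerprod n y x)%:C%C =
  \sum_(phi : {ffun 'I_d -> 'I_n.*2.+1}) (\prod_j kcoef R n (phi j))%:C%C *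
    expi (2 * pi * (dot (freq phi) x - dot (freq phi) y)).
  rewrite rmorph_prod/=; under eq_bigr do rewrite kappaE.
  rewrite bigA_distr_bigA/=; apply: eq_bigr => phi _.
  rewrite big_split/= rmorph_prod; congr (_ * _).
  rewrite -expi_sum; congr expi; rewrite /dot -sumrB mulr_sumr.
  apply: eq_bigr => j _; rewrite !mxE intrB -!pmulrn; ring.
move=> /(congr1 (@complex.Re R)); rewrite Re_sum /= => ->.
by apply: eq_bigr => phi _; rewrite mul0r subr0.
Qed.

Lemma kerprod_ge0 n y x : 0 <= kerprod n y x.
Proof. by apply: prodr_ge0 => j _; exact: kappa_ge0. Qed.

(** The normalization costs only 4^n / 'C(2n, n) <= 2n + 1, while the base (1 + cos(2 pi t)) / 2 is
    below 1 away from the integers. *)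
Lemma kappa_le n (t : R) : kappa n t <= n.*2.+1%:R * ((1 + cos (2 * pi * t)) / 2) ^+ n.
Proof.
rewrite /kappa ler_pdivrMr ?central_bin_gt0//.
have -> : 2 + 2 * cos (2 * pi * t) = 4 * ((1 + cos (2 * pi * t)) / 2) by lra.
rewrite exprMn [leRHS]mulrAC; apply: ler_wpM2r.
  by apply: exprn_ge0; have := cos_geN1 (2 * pi * t); lra.
by rewrite -natrX -natrM ler_nat expn4_leq_central_bin.
Qed.

Lemma kappa_le_cst n (t : R) : kappa n t <= n.*2.+1%:R.
Proof.
apply: le_trans (kappa_le n t) _; rewrite ler_piMr// exprn_ile1//.
by have := cos_le1 (2 * pi * t); lra.
Qed.

Lemma kerprod_le n y x : kerprod n y x <= n.*2.+1%:R ^+ d.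
Proof.
rewrite -[X in _ ^+ X]card_ord -prodr_const; apply: ler_prod => j _.
by rewrite kappa_ge0 kappa_le_cst.
Qed.

Lemma row_of_tupleE (t : d.-tuple R) j : row_of_tuple t ord0 j = tnth t j.
Proof. by rewrite mxE. Qed.

Lemma measurable_cube_tuple : measurable D.
Proof.
have -> : D = \bigcap_(j in [set: 'I_d])
    ((tnth (T:=measurableTypeR R))^~ j @^-1` `[0, 1[%classic).
  rewrite eqEsubset; split => t /= tD.
    by move=> j _ /=; rewrite in_itv/=; have := tD j; rewrite row_of_tupleE.
  by move=> j; have := tD j I; rewrite /= in_itv/= row_of_tupleE.
apply: fin_bigcap_measurable => // j _.
rewrite -[X in measurable X]setTI; exact: measurable_tnth.
Qed.

Lemma measurable_kerprod n y :
  measurable_fun setT (fun t => kerprod n y (row_of_tuple t) : R).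
Proof.
rewrite (_ : (fun t => _) =
    (fun t : d.-tuple R => \prod_j kappa n (tnth t j - y ord0 j))); last first.
  by apply/funext => t; apply: eq_bigr => j _; rewrite row_of_tupleE.
apply: (@measurable_prod_tnth R d (fun j s => kappa n (s - y ord0 j))) => j.
by apply: continuous_measurable_fun => s; exact: continuous_kappa.
Qed.

Lemma integral_kerprod n y :
  (\int[mu]_(t in D) (kerprod n y (row_of_tuple t))%:E = 1)%E.
Proof.
rewrite -[RHS](@integral_lebesgue_tuple_prod R d
  (fun j s => kappa n (s - y ord0 j) * \1_`[0%R, 1%R[ s)).
- rewrite integral_mkcond; apply: eq_integral => t _.
  rewrite patchE big_split/=; case: ifPn => tD.
    rewrite [X in _ = (_ * X)%:E]big1 ?mulr1.
      by congr EFin; apply: eq_bigr => j _; rewrite row_of_tupleE.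
    move=> j _; rewrite indicE mem_set//= in_itv/= -row_of_tupleE.
    by move: tD; rewrite inE => /(_ j).
  have [j tj] : exists j, tnth t j \notin `[0, 1[%classic.
    apply/not_existsP => tI; move/negP: tD; apply; rewrite inE => j.
    have := tI j; rewrite row_of_tupleE => /negP; rewrite negbK.
    by rewrite inE /= in_itv.
  by rewrite (bigD1 j)//= [X in _ * X](bigD1 j)//= indicE (negbTE tj) mul0r mulr0.
- move=> j; apply: measurable_funM; last exact: measurable_indic.
  by apply: continuous_measurable_fun => s; exact: continuous_kappa.
- by move=> j s; rewrite mulr_ge0 ?kappa_ge0.
- by move=> j; exact: integral_kappa_itv.
Qed.

(** For n = 0 the kernel is the constant 1. *)
Lemma lebesgue_cube_tuple : (mu D = 1)%E.
Proof.
rewrite -(integral_kerprod 0 0); under [RHS]eq_integral.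
  move=> t _; rewrite /kerprod big1; last first.
    by move=> j _; rewrite /kappa expr0 bin0 divr1.
  over.
by rewrite integral_cst ?mul1e//; exact: measurable_cube_tuple.
Qed.

Lemma measurable_dot k : measurable_fun setT (fun t => dot k (row_of_tuple t) : R).
Proof.
apply: (@measurable_sum _ _ R _ _ _ (fun j (t : d.-tuple (measurableTypeR R)) =>
  (k ord0 j)%:~R * row_of_tuple t ord0 j)) => j.
apply: measurable_funM => //.
rewrite (_ : (fun t => _) = (fun t : d.-tuple (measurableTypeR R) => tnth t j)).
  exact: measurable_tnth.
by apply/funext => t; rewrite row_of_tupleE.
Qed.

Lemma cube_integrableM f (g : 'rV[R]_d -> R) (M : R) : cube_integrable f ->
  measurable_fun setT (fun t => g (row_of_tuple t) : R) ->
  (forall x, `|g x| <= M) -> cube_integrable (fun x => f x * g x).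
Proof.
move=> fi mg gM.
have /= := integrableMl measurable_cube_tuple fi (measurable_funTS mg).
move=> H; apply: H.
exists M; split; first exact: num_real.
by move=> x Mx t _ /=; exact: le_trans (gM _) (ltW _).
Qed.

Lemma cube_integrable_cst (c : R) : cube_integrable (fun _ : 'rV[R]_d => c).
Proof.
apply/integrableP; split; first exact/measurable_EFinP/measurable_cst.
rewrite /= integral_cst//; last exact: measurable_cube_tuple.
rewrite [X in (_ * X)%E](_ : _ = 1%E); first by rewrite mule1 ltry.
exact: lebesgue_cube_tuple.
Qed.

End cube.

(** * Exponential decay against polynomial growth *)

Section poly_geometric.
Variable R : realType.

(** With q = s^2, one factor s^n absorbs one factor 2n + 1 and the other is left to the induction on
    d. *)
Lemma mulrn_expr_bounded (q : R) d : 0 <= q < 1 ->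
  exists B, forall n, n.*2.+1%:R ^+ d * q ^+ n <= B.
Proof.
elim: d q => [|d IH] q /andP[q0 q1].
  by exists 1 => n; rewrite expr0 mul1r exprn_ile1// ltW.
pose s := Num.sqrt q.
have s0 : 0 <= s by exact: sqrtr_ge0.
have s1 : s < 1 by rewrite -sqrtr1 ltr_sqrt.
have sq : s ^+ 2 = q by exact: sqr_sqrtr.
have [|B hB] := IH s; first by rewrite s0.
exists (B * (2 / (1 - s) + 1)) => n.
have -> : n.*2.+1%:R ^+ d.+1 * q ^+ n =
    (n.*2.+1%:R ^+ d * s ^+ n) * (n.*2.+1%:R * s ^+ n).
  by rewrite -sq -exprM mul2n -addnn exprD exprS; ring.
(* Each of the n terms s^i with i < n is at least s^n, and their sum is (1 - s^n) / (1 - s). *)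
have ns : n%:R * s ^+ n <= (1 - s)^-1.
  have : (1 - s) * (n%:R * s ^+ n) <= 1; last first.
    by rewrite mulrC -ler_pdivlMr ?subr_gt0// mul1r.
  apply: (@le_trans _ _ (1 - s ^+ n)); last by rewrite gerBl exprn_ge0.
  have -> : 1 - s ^+ n = (1 - s) * \sum_(i < n) s ^+ i.
    by rewrite -[1 - s]opprB mulNr -subrX1 opprB.
  apply: ler_wpM2l; first by rewrite subr_ge0 ltW.
  rewrite mulr_natl -[X in _ *+ X]card_ord -sumr_const; apply: ler_sum => i _.
  by apply: ler_wiXn2l; [|exact: ltW|exact/ltnW/ltn_ord].
apply: ler_pM.
- by rewrite mulr_ge0// exprn_ge0.
- by rewrite mulr_ge0// exprn_ge0.
- exact: hB.
- have -> : n.*2.+1%:R * s ^+ n = 2 * (n%:R * s ^+ n) + s ^+ n.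
    by rewrite -addn1 -muln2 natrD natrM; ring.
  by rewrite lerD// ?ler_pM2l// exprn_ile1// ltW.
Qed.

Lemma cvg_mulrn_expr (q : R) d : 0 <= q < 1 ->
  (fun n => n.*2.+1%:R ^+ d * q ^+ n : R) @ \oo --> (0 : R).
Proof.
move=> /andP[q0 q1]; pose s := Num.sqrt q.
have s0 : 0 <= s by exact: sqrtr_ge0.
have s1 : s < 1 by rewrite -sqrtr1 ltr_sqrt.
have sq : s ^+ 2 = q by exact: sqr_sqrtr.
have [|B hB] := @mulrn_expr_bounded s d; first by rewrite s0.
apply: (@squeeze_cvgr _ _ _ _ (fun=> 0) (fun n => B * s ^+ n)).
- near=> n; rewrite mulr_ge0 ?exprn_ge0//=.
  rewrite -[q]sq -exprM mulnC exprM expr2 mulrA.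
  by apply: ler_wpM2r; [exact: exprn_ge0|exact: hB].
- exact: cvg_cst.
- rewrite -[X in _ --> X](mulr0 B); apply: cvgMl_tmp.
  by apply: cvg_expr; rewrite ger0_norm.
Unshelve. all: by end_near. Qed.

(** The cosine decreases on the first half period, and the reflection v -> 1 - v brings the second
    half back to the first. *)
Lemma cos_period_le (e u : R) : 0 < e -> e <= `|u| <= 1 - e ->
  cos (2 * pi * u) <= cos (2 * pi * e).
Proof.
move=> e0 /andP[eu ue].
have -> : cos (2 * pi * u) = cos (2 * pi * `|u|).
  by rewrite -cos_norm normrM ger0_norm// mulr_ge0// pi_ge0.
move: `|u| eu ue => v ev ve.
have key w : e <= w <= 2^-1 -> cos (2 * pi * w) <= cos (2 * pi * e).
  move=> /andP[ew w2]; have p0 := pi_gt0 R.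
  rewrite leNgt; apply/negP => h.
  suff : (2 * pi * w < 2 * pi * e) by rewrite ltr_pM2l ?mulr_gt0// ltNge ew.
  have wp : 2 * pi * w <= pi by nra.
  have ep : 2 * pi * e <= 2 * pi * w by nra.
  rewrite -ltr_cos// in_itv/=; apply/andP; split; nra.
have [v2|v2] := leP v 2^-1; first by apply: key; rewrite ev.
have -> : cos (2 * pi * v) = cos (2 * pi * (1 - v)).
  by rewrite -[RHS]cosN -(cosD2pi_int (- _) 1); congr cos; ring.
apply: key; apply/andP; split; lra.
Qed.

End poly_geometric.

(** * Pointwise convergence of the smoothed functions *)

Section smoothing.
Variables (R : realType) (d : nat).
Implicit Types (x y : 'rV[R]_d) (f : 'rV[R]_d -> R).

(** As the kernel is even, this is the convolution of the periodic extension of f with it. *)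
Definition smooth n f y : R := cube_integral (fun x => f x * kerprod n y x).

Lemma kerprod_cube_integrable n y f : cube_integrable f ->
  cube_integrable (fun x => f x * kerprod n y x).
Proof.
move=> fi; apply: (cube_integrableM fi (measurable_kerprod n y)) => x.
by rewrite ger0_norm ?kerprod_ge0//; exact: kerprod_le.
Qed.

(** The j-th factor supplies the exponential decay; the others cost at most 2n + 1 each. *)
Lemma kerprod_far n y x (e : R) j : 0 < e ->
  e <= `|x ord0 j - y ord0 j| <= 1 - e ->
  kerprod n y x <= n.*2.+1%:R ^+ d * ((1 + cos (2 * pi * e)) / 2) ^+ n.
Proof.
move=> e0 xy; set q := _ / 2.
pose a i : R := if i == j then q ^+ n else 1.
have cN (t : R) : 0 <= (1 + cos (2 * pi * t)) / 2 by have := cos_geN1 (2 * pi * t); lra.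
have -> : n.*2.+1%:R ^+ d * q ^+ n = \prod_(i < d) (n.*2.+1%:R * a i).
  rewrite big_split/= prodr_const card_ord; congr (_ * _).
  by rewrite (bigD1 j)//= big1 ?mulr1 /a ?eqxx// => i /negbTE ->.
apply: ler_prod => i _; rewrite kappa_ge0/= /a; case: eqP => [->|_].
  apply: le_trans (kappa_le _ _) _; apply: ler_wpM2l => //.
  rewrite lerXn2r ?nnegrE ?cN//.
  by rewrite /q ler_pM2r ?invr_gt0// lerD2l; exact: cos_period_le.
by rewrite mulr1; exact: kappa_le_cst.
Qed.

Lemma cube_integrableD f g : cube_integrable f -> cube_integrable g ->
  cube_integrable (fun x => f x + g x).
Proof. by move=> fi gi; exact: (integrableD (@measurable_cube_tuple R d) fi gi). Qed.

Lemma cube_integrableB f g : cube_integrable f -> cube_integrable g ->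
  cube_integrable (fun x => f x - g x).
Proof. by move=> fi gi; exact: (integrableB (@measurable_cube_tuple R d) fi gi). Qed.

Lemma cube_integrableZl (c : R) f : cube_integrable f ->
  cube_integrable (fun x => c * f x).
Proof. by move=> fi; exact: (integrableZl (@measurable_cube_tuple R d) c fi). Qed.

Lemma cube_integrable_norm f : cube_integrable f ->
  cube_integrable (fun x => `|f x|).
Proof. exact: integrable_norm. Qed.

Lemma cube_integralB f g : cube_integrable f -> cube_integrable g ->
  cube_integral (fun x => f x - g x) = cube_integral f - cube_integral g.
Proof. by move=> fi gi; apply: RintegralB => //; exact: measurable_cube_tuple. Qed.

Lemma le_cube_integral f g : cube_integrable f -> cube_integrable g ->
  (forall x, cube x -> f x <= g x) -> cube_integral f <= cube_integral g.
Proof.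
move=> fi gi fg; apply: le_Rintegral => // [|t]; last exact: fg.
exact: measurable_cube_tuple.
Qed.

Lemma le_norm_cube_integral f : cube_integrable f ->
  `|cube_integral f| <= cube_integral (fun x => `|f x|).
Proof. by move=> fi; apply: le_normr_Rintegral => //; exact: measurable_cube_tuple. Qed.

Lemma cube_integralD f g : cube_integrable f -> cube_integrable g ->
  cube_integral (fun x => f x + g x) = cube_integral f + cube_integral g.
Proof. by move=> fi gi; apply: RintegralD => //; exact: measurable_cube_tuple. Qed.

Lemma cube_integralZl (c : R) f : cube_integrable f ->
  cube_integral (fun x => c * f x) = c * cube_integral f.
Proof. by move=> fi; apply: RintegralZl => //; exact: measurable_cube_tuple. Qed.

Lemma cube_integral_kerprod n y : cube_integral (kerprod n y) = 1.
Proof. by rewrite /cube_integral /Rintegral integral_kerprod. Qed.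

(** Approximate identity: near y continuity controls f, and the kernel has mass 1; elsewhere some
    coordinate is far from y, the kernel is uniformly small there, and integrability of f
    suffices. *)
Lemma smooth_cvg f y : {within @cube R d, continuous f} -> cube_integrable f ->
  (forall j, 0 < y ord0 j < 1) -> smooth n f y @[n --> \oo] --> f y.
Proof.
move=> fc fi y01.
have yc : cube y by move=> j; have /andP[/ltW-> ->] := y01 j.
apply/cvgrPdist_le => eta eta0.
have eta2 : 0 < eta / 2 by rewrite divr_gt0.
have /subspace_continuousP/(_ y yc)/cvgrPdist_lt/(_ _ eta2) := fc.
rewrite near_withinE => /nbhs_ballP[/= r r0 fr].
(* The bound r serves continuity and 1/4 keeps 2 pi e within [0, pi]. The distances to the faces
   ensure |x_j - y_j| <= 1 - e on the cube, so the periodic kernel has no second peak there. *)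
pose e := \big[Num.min/Num.min r (4^-1)]_j Num.min (y ord0 j) (1 - y ord0 j).
have e0 : 0 < e.
  apply: lt_bigmin; first by rewrite lt_min r0 invr_gt0 ltr0n.
  by move=> j _; rewrite lt_min subr_gt0.
have er : e <= r by apply: le_trans (bigmin_le_id _ _ _ _) _; rewrite ge_min lexx.
have e4 : e <= 4^-1.
  by apply: le_trans (bigmin_le_id _ _ _ _) _; rewrite ge_min lexx orbT.
have ey j : e <= y ord0 j /\ e <= 1 - y ord0 j.
  have : e <= Num.min (y ord0 j) (1 - y ord0 j) by exact: bigmin_le.
  by move=> h; split; apply: le_trans h _; rewrite ge_min lexx ?orbT.
pose q := (1 + cos (2 * pi * e)) / 2.
have q01 : 0 <= q < 1.
  have p0 := pi_gt0 R.
  have pe0 : 0 < 2 * pi * e by rewrite !mulr_gt0.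
  have pep : 2 * pi * e <= pi by nra.
  have : cos (2 * pi * e) < cos 0.
    by rewrite ltr_cos// in_itv/= ?lexx ?(ltW p0)// (ltW pe0).
  by rewrite cos0 /q; have := cos_geN1 (2 * pi * e) => *; apply/andP; split; lra.
pose L := cube_integral (fun x => `|f y - f x|).
have fyi : cube_integrable (fun x => f y - f x).
  exact: cube_integrableB (cube_integrable_cst d (f y)) fi.
have nfyi := cube_integrable_norm fyi.
have L0 : 0 <= L by apply: Rintegral_ge0.
have kint n : cube_integrable (kerprod n y).
  have := kerprod_cube_integrable n y (cube_integrable_cst d 1).
  by under [X in cube_integrable X]eq_fun do rewrite mul1r.
have bound n : `|f y - smooth n f y| <=
    eta / 2 + n.*2.+1%:R ^+ d * q ^+ n * L.
  have fK := kerprod_cube_integrable n y fyi.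
  have -> : f y - smooth n f y =
      cube_integral (fun x => (f y - f x) * kerprod n y x).
    rewrite [X in cube_integral X](_ : _ = fun x =>
      f y * kerprod n y x - f x * kerprod n y x); last first.
      by apply/funext => x; rewrite mulrBl.
    rewrite cube_integralB; last 2 first.
    - exact: cube_integrableZl.
    - exact: kerprod_cube_integrable.
    by rewrite cube_integralZl// cube_integral_kerprod mulr1.
  apply: le_trans (le_norm_cube_integral fK) _.
  have -> : eta / 2 + n.*2.+1%:R ^+ d * q ^+ n * L = cube_integral (fun x =>
      eta / 2 * kerprod n y x + n.*2.+1%:R ^+ d * q ^+ n * `|f y - f x|).
    rewrite cube_integralD; [|exact: cube_integrableZl|exact: cube_integrableZl].
    by rewrite !cube_integralZl// cube_integral_kerprod mulr1.
  apply: le_cube_integral.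
  - exact: cube_integrable_norm.
  - apply: (@cube_integrableD (fun x => _ * _) (fun x => _ * _)).
      exact: cube_integrableZl.
    exact: cube_integrableZl.
  move=> x xD /=.
  rewrite normrM (ger0_norm (kerprod_ge0 n y x)).
  have [near_y|] := pselect (forall j, `|x ord0 j - y ord0 j| < e).
    apply: (@le_trans _ _ (eta / 2 * kerprod n y x)).
      apply: ler_wpM2r; first exact: kerprod_ge0.
      apply/ltW/fr => //; split => // i j.
      by rewrite ord1 /ball/= distrC (lt_le_trans (near_y j)).
    rewrite lerDl !mulr_ge0// exprn_ge0//; by case/andP: q01.
  move=> /existsNP[j /negP]; rewrite -leNgt => xj.
  apply: (@le_trans _ _ (n.*2.+1%:R ^+ d * q ^+ n * `|f y - f x|)).
    rewrite mulrC; apply: ler_wpM2r => //; apply: (@kerprod_far _ _ _ e j) => //.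
    rewrite xj/=; have /andP[x0 x1] := xD j; have [? ?] := ey j.
    by rewrite ler_norml; apply/andP; split; lra.
  by rewrite lerDr mulr_ge0 ?kerprod_ge0// ltW.
have MM : (fun n => n.*2.+1%:R ^+ d * q ^+ n * L) @ \oo --> (0 : R).
  by rewrite -[X in _ --> X](mul0r L); apply: cvgMr_tmp; exact: cvg_mulrn_expr.
have /cvgrPdist_le/(_ _ eta2) := MM.
apply: filterS => n; rewrite sub0r normrN => Mn.
apply: le_trans (bound n) _; rewrite {2}(splitr eta) lerD2l.
exact: le_trans (ler_norm _) Mn.
Qed.

End smoothing.

(** * Lattice rules *)

Section lattice.
Variables (R : realType) (d : nat).
Implicit Types (k : 'rV[int]_d) (f : 'rV[R]_d -> R).

(* Shifting the lattice by half a cell keeps the nodes away from the faces of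
   the cube, where nothing constrains f to be periodic. *)
Definition lattice_node p (z : {ffun 'I_d -> 'I_p}) (h : 'I_p) : 'rV[R]_d :=
  \row_j ((((h * z j) %% p)%N%:R + 2^-1) / p%:R).

Lemma lattice_node_gt0_lt1 p (z : {ffun 'I_d -> 'I_p}) h j :
  0 < lattice_node z h ord0 j < 1.
Proof.
have p0 : (0 < p)%N by exact: leq_ltn_trans (ltn_ord h).
have pR : 0 < p%:R :> R by rewrite ltr0n.
rewrite mxE divr_gt0//= ?ltr_wpDl ?invr_gt0//.
rewrite ltr_pdivrMr// mul1r; set m := (_ %% p)%N.
have : m.+1%:R <= p%:R :> R by rewrite ler_nat ltn_pmod.
by rewrite -addn1 natrD; lra.
Qed.

Lemma lattice_node_cube p (z : {ffun 'I_d -> 'I_p}) h : cube (lattice_node z h).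
Proof. by move=> j; have /andP[/ltW-> ->] := lattice_node_gt0_lt1 z h j. Qed.

Definition lattice_rule p (z : {ffun 'I_d -> 'I_p}) : linear_algorithm R d :=
  LinearAlgorithm (fun=> p%:R^-1) (@lattice_node_cube p z).

(** The phases form a geometric progression in h, up to a constant factor due to the half-cell
    shift. *)
Lemma expi_dot_lattice_node p (z : {ffun 'I_d -> 'I_p}) k (h : 'I_p) :
  expi (2 * pi * dot k (lattice_node z h)) =
  expi (2 * pi * (zdot k z)%:~R / p%:R) ^+ h *
  expi (pi * (\sum_j (k ord0 j)%:~R) / p%:R : R).
Proof.
have p0 : (0 < p)%N by exact: leq_ltn_trans (ltn_ord h).
have pR : p%:R != 0 :> R by rewrite pnatr_eq0 -lt0n.
(* The quotients discarded by the reductions mod p add up to an integer number of turns. *)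
pose q : int := \sum_j k ord0 j * ((h * z j) %/ p)%N%:Z.
rewrite -expi_mulrn -[RHS]mulr1 -(@expi_2pi_int R (- q)) -!expiD; congr expi.
rewrite /dot /zdot /q.
have E j : (((h * z j) %% p)%N%:R : R) = h%:R * (z j)%:R - ((h * z j) %/ p)%N%:R * p%:R.
  by rewrite -!natrM {2}(divn_eq (h * z j) p) natrD addrAC subrr add0r.
rewrite intrN !rmorph_sum/= !mulr_sumr !mulr_suml -sumrMnl -!big_split/= -sumrN.
rewrite !mulr_sumr -!big_split/=; apply: eq_bigr => j _.
rewrite mxE E !rmorphM/= -!pmulrn -mulr_natr.
by field.
Qed.

(** With r the nonzero residue of m, t = pi r / p lies strictly between 0 and pi, so sin t > 0 and
    cos(2t) < 1. *)
Lemma expi_2pi_frac_neq1 p (m : int) : (0 < p)%N -> ~~ (p%:Z %| m)%Z ->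
  expi (2 * pi * m%:~R / p%:R : R) != 1.
Proof.
move=> p0 pm; have pR : 0 < p%:R :> R by rewrite ltr0n.
pose r := (m %% p%:Z)%Z.
have pz : p%:Z != 0 by case: p p0 {pm pR r}.
have r0 : 0 < r.
  rewrite lt_neqAle modz_ge0// andbT eq_sym; apply: contra pm => /eqP r0.
  by apply/dvdz_mod0P.
have rp : r < p%:Z by exact: ltz_pmod.
have -> : 2 * pi * m%:~R / p%:R =
    2 * pi * r%:~R / p%:R + 2 * pi * (m %/ p%:Z)%Z%:~R :> R.
  rewrite {1}(divz_eq m p%:Z) -/r intrD intrM -pmulrn.
  by field; rewrite gt_eqF.
rewrite expiD expi_2pi_int mulr1; apply/eqP => /(congr1 (@complex.Re R))/=.
set t := pi * r%:~R / p%:R : R.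
have -> : 2 * pi * r%:~R / p%:R = t *+ 2 by rewrite /t -mulr_natl; ring.
rewrite cos_mulr2n => c1.
have t0 : 0 < t by rewrite divr_gt0// mulr_gt0 ?pi_gt0 ?ltr0z.
have tpi : t < pi.
  by rewrite /t ltr_pdivrMr// ltr_pM2l ?pi_gt0// pmulrn ltr_int.
have : 0 < sin t by apply: sin_gt0_pi; rewrite t0.
have := cos2Dsin2 t; nra.
Qed.

(** A geometric sum whose ratio w satisfies w^p = 1 and w != 1. *)
Lemma lattice_char_sum p (z : {ffun 'I_d -> 'I_p}) k : ~~ (p%:Z %| zdot k z)%Z ->
  \sum_(h < p) expi (2 * pi * dot k (lattice_node z h)) = 0.
Proof.
case: (posnP p) => p0.
  by move=> _; apply: big1 => h; have := ltn_ord h; rewrite {2}p0.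
move=> pm; under eq_bigr do rewrite expi_dot_lattice_node.
rewrite -mulr_suml; set w := expi _; apply/eqP; rewrite mulf_eq0; apply/orP; left.
have : (w - 1) * \sum_(i < p) w ^+ i = 0.
  rewrite -subrX1 /w -expi_mulrn.
  have -> : (2 * pi * (zdot k z)%:~R / p%:R) *+ p = 2 * pi * (zdot k z)%:~R :> R.
    by rewrite -mulr_natr divfK// pnatr_eq0 -lt0n.
  by rewrite expi_2pi_int subrr.
by move/eqP; rewrite mulf_eq0 subr_eq0 (negbTE (expi_2pi_frac_neq1 p0 pm)).
Qed.

End lattice.

(** * Fourier expansion of the smoothed function and error of one rule *)

Section fourier.
Variables (R : realType) (d : nat).
Implicit Types (k : 'rV[int]_d) (f : 'rV[R]_d -> R).
Local Notation normc := ComplexField.Normc.normc.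

Lemma normc_ge0 (a : R[i]) : 0 <= normc a.
Proof. by case: a => u v; exact: sqrtr_ge0. Qed.

Lemma normcM_le1 (a b : R[i]) : normc b <= 1 -> `|complex.Re (a * b)| <= normc a.
Proof.
move=> b1; apply: (@le_trans _ _ (normc (a * b))); last first.
  by rewrite ComplexField.Normc.normcM ler_piMr// normc_ge0.
case: (a * b) => u v /=; rewrite -sqrtr_sqr; apply: ler_wsqrtr.
by rewrite lerDl sqr_ge0.
Qed.

Lemma normc_expi (a : R) : normc (expi a) = 1.
Proof. by rewrite /= cos2Dsin2 sqrtr1. Qed.

Lemma normc_sum (I : Type) (s : seq I) (F : I -> R[i]) :
  normc (\sum_(i <- s) F i) <= \sum_(i <- s) normc (F i).
Proof.
elim: s => [|i s IH]; first by rewrite !big_nil ComplexField.Normc.normc0.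
rewrite !big_cons; apply: le_trans (le_normcD _ _) _.
by rewrite lerD2l.
Qed.

Lemma cube_integrable_cos f k (c : R) : cube_integrable f ->
  cube_integrable (fun x => f x * cos (2 * pi * dot k x + c)).
Proof.
move=> fi; apply: (cube_integrableM (M := 1) fi) => [|x]; last exact: cos_max.
apply: measurableT_comp; first exact: continuous_measurable_fun (@continuous_cos R).
apply: measurable_funD; last exact: measurable_cst.
by apply: measurable_funM; [exact: measurable_cst|exact: measurable_dot].
Qed.

Lemma cube_integral_cos f k y : cube_integrable f ->
  cube_integral (fun x => f x * cos (2 * pi * (dot k x - dot k y))) =
  complex.Re (fourier_coef f k * expi (2 * pi * dot k y)).
Proof.
move=> fi; set b := 2 * pi * dot k y.
have E1 : complex.Re (fourier_coef f k) =
    cube_integral (fun x => f x * cos (2 * pi * dot k x + 0)).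
  congr cube_integral; apply/funext => x /=.
  by rewrite mul0r subr0 cosN addr0.
(* The sine is written as a shifted cosine, so that [cube_integrable_cos] covers both parts. *)
have E2 : complex.Im (fourier_coef f k) =
    cube_integral (fun x => f x * cos (2 * pi * dot k x + pi / 2)).
  congr cube_integral; apply/funext => x /=.
  by rewrite mul0r addr0 sinN cosDpihalf.
have -> : complex.Re (fourier_coef f k * expi b) =
    complex.Re (fourier_coef f k) * cos b - complex.Im (fourier_coef f k) * sin b.
  by case: (fourier_coef f k).
rewrite E1 E2 ![cube_integral _ * _]mulrC.
rewrite -!cube_integralZl; [|exact: cube_integrable_cos..].
rewrite -cube_integralB; [|by apply: cube_integrableZl; exact: cube_integrable_cos..].
congr cube_integral; apply/funext => x.
by rewrite mulrBr -/b cosB cosDpihalf addr0; ring.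
Qed.

Lemma smoothE n f y : cube_integrable f -> smooth n f y =
  \sum_(phi : {ffun 'I_d -> 'I_n.*2.+1}) (\prod_j kcoef R n (phi j)) *
    complex.Re (fourier_coef f (freq phi) * expi (2 * pi * dot (freq phi) y)).
Proof.
move=> fi.
under eq_bigr do rewrite -cube_integral_cos//.
rewrite /smooth; under [X in cube_integral X]eq_fun => x do
  rewrite kerprod_cosE mulr_sumr.
have ci phi : cube_integrable (fun x => f x *
    cos (2 * pi * (dot (@freq d n phi) x - dot (freq phi) y))).
  have := @cube_integrable_cos f (freq phi) (- (2 * pi * dot (freq phi) y)) fi.
  by under eq_fun do rewrite -mulrBr.
rewrite {1}/cube_integral Rintegral_sum; last 2 first.
- exact: measurable_cube_tuple.
- move=> phi; have := cube_integrableZl (\prod_j kcoef R n (phi j)) (ci phi).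
  by under eq_fun do rewrite mulrCA.
apply: eq_bigr => phi _; rewrite -cube_integralZl//.
by apply: eq_Rintegral => t _; rewrite mulrCA.
Qed.

(** The rule reproduces the integral from the frequency 0 and annihilates each harmonic with p not
    dividing k.z; on the others the averaged phases and the kernel coefficients have modulus at most
    1. *)
Lemma lattice_error_smooth n f p (z : {ffun 'I_d -> 'I_p}) :
  (0 < p)%N -> cube_integrable f ->
  `|cube_integral f - run (lattice_rule R z) (smooth n f)| <=
  \sum_(phi : {ffun 'I_d -> 'I_n.*2.+1} | freq phi != 0)
    normc (fourier_coef f (freq phi)) * (p%:Z %| zdot (freq phi) z)%Z%:R.
Proof.
move=> p0 fi; have pR : 0 < p%:R :> R by rewrite ltr0n.
pose ck (phi : {ffun 'I_d -> 'I_n.*2.+1}) := \prod_j kcoef R n (phi j).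
(* The value of the rule on the k-th harmonic. *)
pose av k := p%:R^-1%:C%C * \sum_(h < p) expi (2 * pi * dot k (lattice_node R z h)).
have runE : run (lattice_rule R z) (smooth n f) =
    \sum_phi ck phi * complex.Re (fourier_coef f (freq phi) * av (freq phi)).
  rewrite /run/=; under eq_bigr do rewrite smoothE// mulr_sumr.
  rewrite exchange_big/=; apply: eq_bigr => phi _.
  have ReZ (c : R) s : complex.Re (c%:C%C * s) = c * complex.Re s.
    by case: s => u v /=; rewrite mul0r subr0.
  have -> : fourier_coef f (freq phi) * av (freq phi) = p%:R^-1%:C%C *
      \sum_(h < p) fourier_coef f (freq phi) *
        expi (2 * pi * dot (freq phi) (lattice_node R z h)).
    by rewrite /av mulrCA mulr_sumr.
  rewrite ReZ Re_sum !mulr_sumr; apply: eq_bigr => h _.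
  by rewrite mulrCA.
have n0 : (n < n.*2.+1)%N by lia.
pose phi0 : {ffun 'I_d -> 'I_n.*2.+1} := [ffun=> Ordinal n0].
have f0 : freq phi0 = 0 by apply/rowP => j; rewrite !mxE ffunE subrr.
have freq0 phi : (freq phi == 0) = (phi == phi0).
  by rewrite -f0; apply/eqP/eqP => [/freq_inj|->].
have dot0 x : dot (0 : 'rV[int]_d) x = 0 :> R.
  by rewrite /dot big1// => j _; rewrite mxE mul0r.
have av0 : av 0 = 1.
  rewrite /av; under eq_bigr do rewrite dot0 mulr0 expi0.
  rewrite sumr_const card_ord -(rmorph_nat (@real_complex R)) -rmorphM/=.
  by rewrite mulVf ?gt_eqF.
have fc0 : complex.Re (fourier_coef f 0) = cube_integral f.
  congr cube_integral; apply/funext => x /=.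
  by rewrite dot0 mulr0 oppr0 cos0 sin0 mulr1 mul0r subr0.
rewrite runE (bigD1 phi0)//= f0 av0 mulr1 fc0 /ck big1 ?mul1r; last first.
  by move=> j _; rewrite ffunE kcoef_mid.
rewrite opprD addrA subrr add0r normrN.
apply: le_trans (ler_norm_sum _ _ _) _.
under [leRHS]eq_bigl do rewrite freq0.
apply: ler_sum => phi _.
have ck1 : 0 <= ck phi <= 1.
  rewrite prodr_ge0 => [|j _]; last exact: kcoef_ge0.
  by apply: prodr_ile1 => j _; rewrite kcoef_ge0 kcoef_le1.
case/andP: ck1 => ck0 ck1; rewrite normrM (ger0_norm ck0).
apply: le_trans (ler_piMl (normr_ge0 _) ck1) _.
case: (boolP (p%:Z %| _)%Z) => pz; last first.
  by rewrite /av lattice_char_sum// !mulr0 normr0.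
rewrite mulr1; apply: normcM_le1; rewrite /av ComplexField.Normc.normcM.
have -> : normc (p%:R^-1%:C%C : R[i]) = p%:R^-1.
  by rewrite /= expr0n addr0 sqrtr_sqr ger0_norm.
rewrite mulrC ler_pdivrMr// mul1r; apply: le_trans (normc_sum _ _) _.
by under eq_bigr do rewrite normc_expi; rewrite sumr_const card_ord.
Qed.

End fourier.

Lemma cvg_sumr (R : realType) (I : Type) (s : seq I) (u : I -> nat -> R) (l : I -> R) :
  (forall i, u i n @[n --> \oo] --> l i) ->
  \sum_(i <- s) u i n @[n --> \oo] --> \sum_(i <- s) l i.
Proof.
move=> ul; elim: s => [|i s IH].
  rewrite big_nil; under eq_fun do rewrite big_nil; exact: cvg_cst.
rewrite big_cons; under eq_fun do rewrite big_cons; exact: cvgD.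
Qed.

(** * Averaging over the random lattice rule *)

Section average.
Variables (R : realType) (d : nat).
Implicit Types (k : 'rV[int]_d) (f : 'rV[R]_d -> R).
Local Notation normc := ComplexField.Normc.normc.

Lemma le_wiener_norm (r : 'rV[int]_d -> R) f (s : seq 'rV[int]_d) : uniq s ->
  ((\sum_(k <- s) normc (fourier_coef f k) * r k)%:E <= wiener_norm r f)%E.
Proof.
move=> us; apply: esum_ge; exists [set` s]; first by split; [exact: finite_seq|].
by rewrite -fsbig_seq// -sumEFin.
Qed.

(** The count of prime divisors is applied to one coordinate of k; the one minimizing |k_j| over the
    support is that whose logarithm [r1] controls. *)
Lemma r1_witness k : k != 0 ->
  exists2 j, k ord0 j != 0 & ln (absz (k ord0 j))%:R <= r1 R k.
Proof.
move=> k0; rewrite /r1; case: pickP => [j0 kj0|k00]; last first.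
  case/eqP: k0; apply/rowP => j; rewrite mxE; apply/eqP.
  by have := k00 j; move/negbT; rewrite negbK.
case: arg_minnP => // j kj _; exists j => //.
by rewrite le_max lexx orbT.
Qed.

Lemma ln2_ge_half : 2^-1 <= ln (2 : R).
Proof.
have -> : (2 : R) = (2^-1)^-1 by rewrite invrK.
rewrite lnV ?posrE ?invr_gt0// lerNr.
have -> : 2^-1 = 1 + - 2^-1 :> R by lra.
by apply: le_trans (le_ln1Dx _) _; lra.
Qed.

(** The factor 2 comes from ln 2 >= 1/2. *)
Lemma prime_divisors_count_ln b m (s : seq nat) : (0 < m)%N -> uniq s ->
  {in s, forall p, [/\ prime p, (2 ^ b <= p)%N & (p %| m)%N]} ->
  (b * size s)%:R <= 2 * ln m%:R :> R.
Proof.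
move=> m0 us sP; have := prime_divisors_count m0 us sP.
rewrite -(ler_nat R) natrX => h.
have : ln ((2 : R) ^+ (b * size s)) <= ln m%:R.
  by rewrite ler_ln ?posrE ?exprn_gt0// ltr0n.
rewrite lnXn// -[ln 2 *+ _]mulr_natl => h2.
rewrite mulrC -ler_pdivrMr//; apply: le_trans h2.
by apply: ler_wpM2l => //; exact: ln2_ge_half.
Qed.

(** Passes from the ordinals that index the samples to the list counted by [many_primes]. *)
Lemma sum_primes_in (V : nmodType) a b (F : nat -> V) : (a <= b)%N ->
  \sum_(p < b.+1 | prime p && (a < p)%N) F p = \sum_(p <- primes_in a b) F p.
Proof.
move=> ab; rewrite -(big_mkord (fun p => prime p && (a < p)%N) F) -big_filter.
apply: perm_big; apply: uniq_perm.
- by rewrite filter_uniq// iota_uniq.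
- by rewrite filter_uniq// iota_uniq.
by move=> p; rewrite !mem_filter mem_index_iota mem_iota; lia.
Qed.

(** The probability, for given p, that p divides k.z. If p divides k_j it is bounded by 1; otherwise
    [card_dual_lattice] gives 1/p. *)
Lemma card_dual_lattice_le p k j : prime p ->
  (p%:R ^+ d)^-1 * (\sum_(z : {ffun 'I_d -> 'I_p}) (p%:Z %| zdot k z)%Z%:R)
  <= p%:R^-1 + (p %| absz (k ord0 j))%N%:R :> R.
Proof.
move=> pp; have pR : 0 < p%:R :> R by rewrite ltr0n prime_gt0.
have pd : 0 < p%:R ^+ d :> R by rewrite exprn_gt0.
rewrite mulrC ler_pdivrMr//.
case: (boolP (p %| _)%N) => pk.
  apply: (@le_trans _ _ (p%:R ^+ d)); last by rewrite ler_peMl ?lerDr ?invr_ge0// ltW.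
  have -> : p%:R ^+ d = #|{ffun 'I_d -> 'I_p}|%:R :> R.
    by rewrite card_ffun !card_ord natrX.
  rewrite -sum1_card natr_sum; apply: ler_sum => z _.
  by rewrite ler_nat leq_b1.
rewrite addr0 mulrC ler_pdivlMr// -natr_sum.
have := @card_dual_lattice d p k j pp pk.
by rewrite -natrX -natrM ler_nat big_mkcond/=; congr (_ <= _)%N; congr (_ * _)%N.
Qed.

Variable b : nat.
Hypothesis b5 : (5 < b)%N.
Let N := (4 ^ b)%N.
Let P (p : nat) := prime p && (4 ^ b.-1 < p)%N.
Let M := size (primes_in (4 ^ b.-1) N).

Let sample := {p : 'I_N.+1 & {ffun 'I_d -> 'I_p}}.

(** A sample is a dependent pair since the range of z depends on p. All p <= N are allowed as
    indices; the boolean factor gives weight 0 to those that are not primes above N/4. *)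
Definition sample_weight (w : {p : 'I_(4 ^ b).+1 & {ffun 'I_d -> 'I_p}}) : R :=
  (prime (tag w) && (4 ^ b.-1 < tag w)%N)%:R *
  ((size (primes_in (4 ^ b.-1) (4 ^ b)))%:R^-1 * ((tag w)%:R ^+ d)^-1).

Let M_gt0 : 0 < M%:R :> R.
Proof.
rewrite ltr0n lt0n; apply: contraTneq (many_primes b5) => M0.
by rewrite -/M M0 muln0 -ltnNge expn_gt0.
Qed.

Lemma sample_weight_ge0 w : 0 <= sample_weight w.
Proof. by rewrite !mulr_ge0// invr_ge0// exprn_ge0. Qed.

Lemma sum_sampleE (X : forall p, {ffun 'I_d -> 'I_p} -> R) :
  \sum_(w : sample) sample_weight w * X _ (tagged w) =
  M%:R^-1 * \sum_(p < N.+1 | P p) (p%:R ^+ d)^-1 * \sum_z X p z.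
Proof.
transitivity (\sum_(p < N.+1) \sum_(z : {ffun 'I_d -> 'I_p})
    sample_weight (existT (fun p : 'I_N.+1 => {ffun 'I_d -> 'I_p}) p z) * X p z).
  by rewrite sig_big_dep/=; apply: eq_bigr => -[p z].
rewrite mulr_sumr [RHS]big_mkcond/=; apply: eq_bigr => p _.
rewrite /sample_weight /= -/M -/N -/(P p); case: (P p).
  by rewrite [RHS]mulrA mulr_sumr; apply: eq_bigr => z _; rewrite mul1r.
by apply: big1 => z _; rewrite !mul0r.
Qed.

Let sum_count (c : R) : \sum_(p < N.+1 | P p) c = c * M%:R.
Proof.
rewrite (sum_primes_in (fun=> c)) ?leq_exp2l//; last exact: leq_pred.
by rewrite big_const_seq count_predT iter_addr_0 mulr_natr.
Qed.

Lemma sum_sample_weight : \sum_(w : sample) sample_weight w = 1.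
Proof.
have := sum_sampleE (fun _ _ => 1).
under [X in X = _ -> _]eq_bigr do rewrite mulr1.
move=> ->; rewrite (_ : \sum_(p < _ | _) _ = \sum_(p < N.+1 | P p) 1).
  by rewrite sum_count mul1r mulVf// gt_eqF.
apply: eq_bigr => p /andP[pp _].
rewrite sumr_const card_ffun !card_ord natrX mulVf// expf_neq0//.
by rewrite pnatr_eq0 -lt0n prime_gt0.
Qed.

(** The constant is 20 = 4 + 16: the term 1/p is below 4/N, and t, the number of eligible primes
    dividing k_j, satisfies b t <= 2 r_1(k), which with N <= 8 b M gives t/M <= 16 r_1(k) / N. *)
Lemma sample_dual_lattice_le k : k != 0 ->
  \sum_(w : sample) sample_weight w * ((val (tag w))%:Z %| zdot k (tagged w))%Z%:R
  <= 20 / N%:R * r1 R k.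
Proof.
move=> k0; have [j kj hj] := r1_witness k0.
set m := absz _ in hj; have m0 : (0 < m)%N by rewrite absz_gt0.
have NR : 0 < N%:R :> R by rewrite ltr0n expn_gt0.
have N4 : N%:R = 4 * (4 ^ b.-1)%:R :> R by rewrite -natrM -expnS prednK//; lia.
rewrite (sum_sampleE (fun p z => (p%:Z %| zdot k z)%Z%:R)).
rewrite ler_pdivrMl//.
apply: (@le_trans _ _ (\sum_(p < N.+1 | P p) (4 / N%:R + (p %| m)%N%:R))).
  apply: ler_sum => p /andP[pp pN]; apply: le_trans (card_dual_lattice_le k j pp) _.
  rewrite lerD2r N4 invfM mulVKf// lef_pV2 ?posrE ?ltr0n ?expn_gt0 ?(prime_gt0 pp)//.
  by rewrite ler_nat ltnW.
rewrite big_split/= sum_count.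
rewrite (sum_primes_in (fun p => (p %| m)%N%:R)) ?leq_exp2l ?leq_pred//.
set t : R := \sum_(p <- _) _.
have tE : t = (size [seq p <- primes_in (4 ^ b.-1) N | (p %| m)%N])%:R.
  rewrite size_filter -sum1_count natr_sum [RHS]big_mkcond.
  by apply: eq_bigr => p _; case: (_ %| _)%N.
have : b%:R * t <= 2 * ln m%:R.
  rewrite tE -natrM; apply: prime_divisors_count_ln => //.
    by rewrite !filter_uniq// iota_uniq.
  move=> p; rewrite !mem_filter mem_iota => /and3P[pm pp /andP[pN _]]; split => //.
  apply: leq_trans (ltnW pN).
  have -> : (4 ^ b.-1 = 2 ^ (2 * b.-1))%N by rewrite expnM.
  by rewrite leq_exp2l//; lia.
have : N%:R <= 8 * b%:R * M%:R :> R by rewrite -!natrM ler_nat; exact: many_primes.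
have r11 := r1_ge1 R k.
have bR : 0 < b%:R :> R by rewrite ltr0n; lia.
move=> hN ht.
rewrite -(ler_pM2l NR).
have -> : N%:R * (M%:R * (20 / N%:R * r1 R k)) = 20 * M%:R * r1 R k.
  by field; rewrite gt_eqF.
have -> : N%:R * (4 / N%:R * M%:R + t) = 4 * M%:R + N%:R * t.
  by field; rewrite gt_eqF.
have t0 : 0 <= t by rewrite tE.
have : N%:R * t <= 16 * M%:R * r1 R k.
  apply: (@le_trans _ _ (8 * b%:R * M%:R * t)); first exact: ler_wpM2r.
  have -> : 8 * b%:R * M%:R * t = 8 * M%:R * (b%:R * t) by ring.
  have -> : 16 * M%:R * r1 R k = 8 * M%:R * (2 * r1 R k) by ring.
  by apply: ler_wpM2l; [exact: mulr_ge0|lra].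
have : 4 * M%:R <= 4 * M%:R * r1 R k by rewrite ler_peMr// mulr_ge0.
lra.
Qed.

(** The bound holds for [smooth n f] uniformly in n; it passes to the limit because finitely many
    nodes are involved, all interior to the cube. *)
Lemma sample_error_le f :
  wiener_space (@r1 R d) f -> (wiener_norm (@r1 R d) f <= 1)%E ->
  \sum_(w : sample) sample_weight w *
     `|cube_integral f - run (lattice_rule R (tagged w)) f| <= 20 / N%:R.
Proof.
move=> [fc fi _] f1.
pose G n := \sum_(w : sample) sample_weight w *
     `|cube_integral f - run (lattice_rule R (tagged w)) (smooth n f)|.
have GG : G n @[n --> \oo] --> \sum_(w : sample) sample_weight w *
     `|cube_integral f - run (lattice_rule R (tagged w)) f|.
  apply: cvg_sumr => w; apply: cvgMl_tmp; apply: cvg_norm.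
  apply: cvgB; first exact: cvg_cst.
  apply: cvg_sumr => h; apply: cvgMl_tmp; apply: smooth_cvg => // j.
  exact: lattice_node_gt0_lt1.
apply: (cvgr_to_le GG).
apply: nearW => n; rewrite /G.
have NR : 0 < N%:R :> R by rewrite ltr0n expn_gt0.
apply: (@le_trans _ _ (\sum_(w : sample)
    \sum_(phi : {ffun 'I_d -> 'I_n.*2.+1} | freq phi != 0)
    normc (fourier_coef f (freq phi)) *
     (sample_weight w * ((val (tag w))%:Z %| zdot (freq phi) (tagged w))%Z%:R))).
  apply: ler_sum => w _.
  (* For p = 0 the weight vanishes, 0 not being prime; [lattice_error_smooth] handles p > 0. *)
  have [w0|w0] := posnP (tag w).
    rewrite {1}/sample_weight {1}w0 !mul0r; apply: sumr_ge0 => phi _.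
    by rewrite !mulr_ge0 ?normc_ge0 ?sample_weight_ge0.
  under eq_bigr do rewrite mulrCA.
  rewrite -mulr_sumr; apply: ler_wpM2l; first exact: sample_weight_ge0.
  exact: lattice_error_smooth.
rewrite exchange_big.
apply: (@le_trans _ _ (\sum_(phi : {ffun 'I_d -> 'I_n.*2.+1} | freq phi != 0)
    20 / N%:R * (normc (fourier_coef f (freq phi)) * r1 R (freq phi)))).
  apply: ler_sum => phi phi0; rewrite -mulr_sumr [leRHS]mulrCA.
  by apply: ler_wpM2l; [exact: normc_ge0|exact: sample_dual_lattice_le].
rewrite -mulr_sumr -[leRHS]mulr1; apply: ler_wpM2l.
  by rewrite divr_ge0// ltW.
(* As [freq] is injective, the sum over phi is bounded by a partial sum of the series defining the
   norm. *)
apply: (@le_trans _ _ (\sum_(k <- [seq @freq d n phi | phi : {ffun 'I_d -> 'I_n.*2.+1}])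
     normc (fourier_coef f k) * r1 R k)).
  rewrite big_image [leRHS](bigID (fun phi => freq phi != 0)) lerDl.
  by apply: sumr_ge0 => phi _; rewrite mulr_ge0 ?normc_ge0// (le_trans ler01)// r1_ge1.
rewrite -lee_fin; apply: le_trans (le_wiener_norm _ _ _) f1.
by rewrite map_inj_uniq ?enum_uniq//; exact: freq_inj.
Qed.

End average.

(** * The randomized algorithm and its complexity *)

Lemma lattice_randomized_algorithm (R : realType) (d b : nat) : (5 < b)%N ->
  exists A : randomized_algorithm (wiener_space (@r1 R d)),
    (ran_error A <= (20 / (4 ^ b)%N%:R)%:E)%E /\
    (ran_card A <= ((4 ^ b)%N%:R)%:E)%E.
Proof.
move=> b5; pose W : finType := {p : 'I_(4 ^ b).+1 & {ffun 'I_d -> 'I_p}}.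
have w1 : \sum_(w : W) sample_weight R w = 1 := sum_sample_weight R d b5.
have [w0 _] : exists w0 : W, true.
  have [w0 _|W0] := pickP (fun _ : W => true); first by exists w0.
  have : (1 : R) = 0 by rewrite -w1; apply: big1 => w; have := W0 w.
  by move/eqP; rewrite oner_eq0.
have [P EP] := finite_probability w0 (@sample_weight_ge0 R d b) w1.
pose alg (i : nat) := lattice_rule R (tagged (nth w0 (enum W) i)).
have mnat (g : nat -> R) : measurable_fun [set: nat] g by move=> _ B _.
pose A := RandomizedAlgorithm P (fun f (_ : wiener_space (@r1 R d) f) =>
  mnat (fun w => run (alg w) f)) (mnat (fun w => (npoints (alg w))%:R)).
exists A; split; apply: ub_ereal_sup => _ [f Ff <-].
  case: Ff => Ff f1.
  rewrite (EP (fun w => `|cube_integral f - run (alg w) f|))//.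
  rewrite lee_fin; apply: le_trans (sample_error_le b5 Ff f1).
  by apply: ler_sum => w _; rewrite /alg nth_index ?mem_enum.
rewrite (EP (fun w => (npoints (alg w))%:R))// lee_fin.
have -> : (4 ^ b)%N%:R = \sum_(w : W) sample_weight R w * (4 ^ b)%N%:R :> R.
  by rewrite -mulr_suml w1 mul1r.
apply: ler_sum => w _.
apply: ler_wpM2l; first exact: sample_weight_ge0.
(* Each rule has p nodes, and p <= N because p is an ordinal below N + 1. *)
by rewrite /alg /= nth_index ?mem_enum// ler_nat -ltnS ltn_ord.
Qed.

Theorem theorem5 (R : realType) :
  exists C : R, 0 < C /\
    forall (d : nat) (eps : R), (0 < d)%N -> 0 < eps < 1 ->
      (ran_complexity (@r1 R d) eps <= (C * eps^-1)%:E)%E.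
Proof.
(* For the least admissible b, either b = 6 and N = 4^6, or minimality gives N/4 < 20/eps, hence N <
   80/eps; 4^6 covers both cases. *)
exists (4 ^+ 6); split => [|d eps]; first by rewrite exprn_gt0.
move=> _ /andP[e0 e1].
have ex : exists b, (5 < b)%N && (20 / eps <= (4 ^ b)%N%:R).
  exists (6 + Num.bound (20 / eps))%N; rewrite leq_addr/=.
  have /ltW h : 20 / eps < (Num.bound (20 / eps))%:R.
    by apply: archi_boundP; rewrite divr_ge0// ltW.
  apply: le_trans h _; rewrite ler_nat.
  apply: leq_trans (ltnW (ltn_expl _ (isT : (1 < 4)%N))) _.
  by rewrite leq_exp2l// leq_addl.
case: (ex_minnP ex) => b /andP[b5 hb] bmin.
have NR : 0 < (4 ^ b)%N%:R :> R by rewrite ltr0n expn_gt0.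
have N0 : (4 ^ b)%N%:R <= 4 ^+ 6 * eps^-1 :> R.
  have [b6|b6] := leqP b 6.
    have -> : b = 6%N by lia.
    by rewrite ler_pdivlMr// natrX ler_piMr ?exprn_ge0// ltW.
  have hb1 : (4 ^ b.-1)%N%:R < 20 / eps.
    rewrite ltNge; apply/negP => h; have := bmin b.-1; rewrite h andbT.
    by case: b b6 {b5 hb bmin NR h} => // b b6 /(_ b6); rewrite ltnn.
  have -> : (4 ^ b = 4 * 4 ^ b.-1)%N by rewrite -expnS prednK//; lia.
  rewrite natrM; apply: (@le_trans _ _ (80 * eps^-1)).
    by move: hb1; set x := (4 ^ b.-1)%N%:R; lra.
  apply: ler_wpM2r; first by rewrite invr_ge0 ltW.
  by rewrite -natrX ler_nat.
have [A [eA cA]] := lattice_randomized_algorithm R d b5.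
apply: (@le_trans _ _ (4 ^ b)%N%:R%:E); last by rewrite lee_fin.
apply: ereal_inf_lbound; exists (4 ^ b)%N => //; split; first by rewrite expn_gt0.
exists A; split => //; apply: le_trans eA _; rewrite lee_fin.
by rewrite ler_pdivrMr// mulrC -ler_pdivrMr.
Qed.
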